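(* Let $X$ be a locally convex space. Suppose that Radon measures $\mu_n$, $n\in\mathbb{N}$, and a Radon measure $\mu$ on $X$ (possibly signed) have barycenters, the measures $\mu_n$ converge weakly to $\mu$, and every continuous seminorm $q$ on $X$ is uniformly integrable with respect to the sequence $\{\mu_n\}$, i.e. $$\lim_{R\to\infty}\sup_n\int_{\{q\ge R\}}q\,d|\mu_n|=0.$$ Then $m_{\mu_n}\to m_\mu$ in $X$. In the case of probability measures, the same is true for nets: if a net of Radon probability measures $\mu_\alpha$ with barycenters converges weakly to a Radon probability measure $\mu$ with a barycenter and $\lim_{R\to\infty}\sup_\alpha\int_{\{q\ge R\}}q\,d\mu_\alpha=0$ for every continuous seminorm $q$, then $m_{\mu_\alpha}\to m_\mu$.
   Context: Locally convex spaces are real and Hausdorff. A finite nonnegative Borel measure $\mu$ is Radon if for every Borel set $B$ and $\varepsilon>0$ there is a compact $K\subset B$ with $\mu(B\setminus K)<\varepsilon$; a signed Borel measure is Radon if its total variation $|\mu|$ is. Weak convergence of measures means convergence of the integrals of every bounded continuous function. A Borel measure $\mu$ on $X$ has a mean (barycenter) $m_\mu\in X$ if $X^*\subset L^1(|\mu|)$ and $f(m_\mu)=\int_X f\,d\mu$ for every $f\in X^*$, where $X^*$ is the space of continuous linear functionals. *)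

(* Defs.v *)
From HB Require Import structures.
From mathcomp Require Import all_boot all_order all_algebra.
From mathcomp Require Import all_classical all_reals all_analysis.

Set Implicit Arguments.
Unset Strict Implicit.
Unset Printing Implicit Defensive.

Import Order.TTheory GRing.Theory Num.Theory.
Import numFieldNormedType.Exports.

Local Open Scope classical_set_scope.
Local Open Scope ring_scope.

(* A measurableType must be pointed, and tvsType does not inherit from
   pointedType; the alias carries the missing instance. *)
Definition pointed_tvs (R : realType) (X : tvsType R) : Type := X.

HB.instance Definition _ (R : realType) (X : tvsType R) :=
  Choice.on (pointed_tvs X).
HB.instance Definition _ (R : realType) (X : tvsType R) :=
  isPointed.Build (pointed_tvs X) (0 : X).

Notation borel X := (@g_sigma_algebraType (pointed_tvs X) (@open X)).

Section charge_total_variation.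
Context d (T : measurableType d) (R : realType).
Variable nu : {charge set T -> \bar R}.

(* The library's Jordan decomposition and variation take a Hahn decomposition
   as an argument; on measurable sets they do not depend on which one is chosen
   (Hahn_decomposition_uniq). *)
Definition hahn_pos : set T := sval (cid (Hahn_decomposition nu)).

Definition hahn_neg : set T :=
  sval (cid (svalP (cid (Hahn_decomposition nu)))).

Lemma hahn_posneg : hahn_decomposition nu hahn_pos hahn_neg.
Proof. exact: (svalP (cid (svalP (cid (Hahn_decomposition nu))))). Qed.

Definition charge_total_variation : {measure set T -> \bar R} :=
  charge_variation hahn_posneg.

Definition charge_integral (f : T -> R) : R :=
  \int[jordan_pos hahn_posneg]_x f x - \int[jordan_neg hahn_posneg]_x f x.

End charge_total_variation.

Section borel_measures.
Context (R : realType) (X : tvsType R).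

Definition radon (mu : {measure set (borel X) -> \bar R}) : Prop :=
  (mu setT < +oo)%E /\
  forall (B : set (borel X)) (e : R), measurable B -> 0 < e ->
    exists K : set X, [/\ compact K, K `<=` B & (mu (B `\` K) < e%:E)%E].

Definition radon_charge (nu : {charge set (borel X) -> \bar R}) : Prop :=
  radon (charge_total_variation nu).

Definition is_mean (mu : {measure set (borel X) -> \bar R}) (m : X) : Prop :=
  forall f : {linear X -> R^o}, continuous f ->
    mu.-integrable [set: borel X] (fun x => (f x)%:E) /\
    f m = \int[mu]_x f x.

Definition is_charge_mean (nu : {charge set (borel X) -> \bar R}) (m : X) :
    Prop :=
  forall f : {linear X -> R^o}, continuous f ->
    (charge_total_variation nu).-integrable [set: borel X] (fun x => (f x)%:E) /\
    f m = charge_integral nu f.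

(* F is the filter along which the index i tends to its limit. *)
Definition weak_cvg (I : Type) (F : set_system I)
    (mu_ : I -> {measure set (borel X) -> \bar R})
    (mu : {measure set (borel X) -> \bar R}) : Prop :=
  forall f : X -> R, continuous f -> bounded_fun f ->
    \int[mu_ i]_x f x @[i --> F] --> \int[mu]_x f x.

Definition weak_charge_cvg (I : Type) (F : set_system I)
    (nu_ : I -> {charge set (borel X) -> \bar R})
    (nu : {charge set (borel X) -> \bar R}) : Prop :=
  forall f : X -> R, continuous f -> bounded_fun f ->
    charge_integral (nu_ i) f @[i --> F] --> charge_integral nu f.

Definition seminorm (q : X -> R) : Prop :=
  [/\ forall x, 0 <= q x,
      forall x y, q (x + y) <= q x + q y &
      forall (a : R) x, q (a *: x) = `|a| * q x].

Definition uniformly_integrable (I : Type)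
    (mu_ : I -> {measure set (borel X) -> \bar R}) (q : X -> R) : Prop :=
  ereal_sup (range (fun i => \int[mu_ i]_(x in [set x | (r <= q x)%R]) (q x)%:E)%E)
    @[r --> +oo%R] --> 0%E.

End borel_measures.

Section nets.
Context (I : Type) (le : I -> I -> Prop).

Definition directed_preorder : Prop :=
  [/\ inhabited I, forall i, le i i,
      forall i j k, le i j -> le j k -> le i k &
      forall i j, exists k, le i k /\ le j k].

Definition tails : set_system I :=
  filter_from [set: I] (fun i => [set j | le i j]).

End nets.

(* Main.v *)
Require Import Defs.
From HB Require Import structures.
From mathcomp Require Import all_boot all_order all_algebra.
From mathcomp Require Import all_classical all_reals all_analysis.
From mathcomp Require Import measurable_realfun.
From mathcomp Require Import ring lra.

(* Let [d x y = q (x - y)] for a continuous seminorm [q].  By Hahn-Banach,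
   [q (m_n - m_k)] is [f m_n - f m_k] for some linear [f] with [|f| <= q], and by
   uniform integrability [f] may be truncated at a level [r] independent of [n],
   [k] and [f].  The truncated functions are uniformly bounded and 1-Lipschitz
   for [d], so the point is that a weakly null sequence of signed measures (here
   [mu_n - mu_k]) tends to zero uniformly on such a class; hence [m_n] is Cauchy,
   and [m] is its limit since it is its weak limit.

   The uniformity is a form of Schur's theorem on l^1.  All the measures are
   carried by one [d]-separable set, on which a countable partition of unity
   [h_i] of mesh [delta] approximates [f] by [sum_i f(x_i) h_i].  As
   [sum_i c_i h_i] is continuous and bounded for every bounded [c], a gliding
   hump argument makes the integrals of these sums tend to zero uniformly in
   [c].  The remainders, of size [delta], are handled by a second gliding hump,
   along a subsequence with [delta = 2^-k].

   For nets of probability measures no gliding hump is needed: finitely many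
   [h_i] carry almost all the mass of the limit, and positivity does the rest. *)

Set Implicit Arguments.
Unset Strict Implicit.
Unset Printing Implicit Defensive.

Import Order.TTheory GRing.Theory Num.Theory.
Import numFieldNormedType.Exports.

Local Open Scope classical_set_scope.
Local Open Scope ring_scope.

(** * The gliding hump *)

Lemma not_cvg0_frequently (R : realType) (u : R^nat) :
  ~ u n @[n --> \oo] --> (0 : R) ->
  exists2 e : R, 0 < e & forall N, exists2 n, (N <= n)%N & e < `|u n|.
Proof.
move=> nu; apply: contrapT => H; apply: nu; apply/cvgr0Pnorm_le => e e0.
apply: contrapT => K; apply: H; exists e => // N.
apply: contrapT => L; apply: K; exists N => // n /= Nn.
by rewrite leNgt; apply/negP => en; apply: L; exists n.
Qed.

Lemma homo_ltn_geq_id (f : nat -> nat) :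
  (forall n, (f n < f n.+1)%N) -> forall n, (n <= f n)%N.
Proof. by move=> fS; elim=> // n IH; exact: leq_ltn_trans IH (fS n). Qed.

(* The hump: the indices are cut into blocks and a single [c] is glued from the
   [c_ n_k], one per block, with [n_k] so sparse that [F n_k c] is close to
   [F n_k (c_ n_k)]. *)
Lemma gliding_hump (R : realType) (V : Type) (D : set V)
    (F : nat -> (nat -> V) -> R) (c_ : nat -> nat -> V) :
  (forall c, (forall i, D (c i)) -> F n c @[n --> \oo] --> (0 : R)) ->
  (forall n (e : R), 0 < e -> exists M, forall c c', (forall i, D (c i)) ->
    (forall i, D (c' i)) -> (forall i, (i < M)%N -> c i = c' i) ->
    `|F n c - F n c'| <= e) ->
  (forall M (e : R), 0 < e -> exists N, forall n c c', (N <= n)%N ->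
    (forall i, D (c i)) -> (forall i, D (c' i)) ->
    (forall i, (M <= i)%N -> c i = c' i) -> `|F n c - F n c'| <= e) ->
  (forall n i, D (c_ n i)) ->
  F n (c_ n) @[n --> \oo] --> (0 : R).
Proof.
move=> F0 Ftail Fhead Dc; apply: contrapT => /not_cvg0_frequently[e e0 bad].
have e4 : 0 < e / 4 by lra.
have /choice[B HB] : forall N, exists n, (N <= n)%N /\ e < `|F n (c_ n)|.
  by move=> N; have [n] := bad N; exists n.
have /choice[M HM] := fun n => Ftail n _ e4.
have /choice[N HN] := fun M => Fhead M _ e4.
(* The state is the pair (n_k, I_k). The next block starts beyond [M n_k], so [F n_k] hardly sees
   the entries after its own block; the next index is at least [N I'], so [F] there hardly sees the
   entries before its block. *)
pose step (p : nat * nat) :=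
  let I' := maxn (M p.1) p.2.+1 in (B (maxn (N I') p.1.+1), I').
pose s k := iter k step (B (N 0), 0)%N.
pose n k := (s k).1; pose I k := (s k).2.
have IS k : (I k < I k.+1)%N by rewrite /I /= leq_max leqnn orbT.
have nS k : (n k < n k.+1)%N.
  rewrite /n /=; set a := maxn _ (_.+1).
  by apply: leq_trans (HB a).1; rewrite /a leq_max leqnn orbT.
have MI k : (M (n k) <= I k.+1)%N by rewrite /n /I /= leq_max leqnn.
have Nn k : (N (I k) <= n k)%N.
  case: k => [|k]; first exact: (HB _).1.
  rewrite /n /=; apply: leq_trans (HB _).1.
  by rewrite leq_max leqnn.
have nbad k : e < `|F (n k) (c_ (n k))|.
  by case: k => [|k]; exact: (HB _).2.
have Imono : {homo I : a b / (a <= b)%N}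
  by exact: (homo_leq leqnn leq_trans (fun k => ltnW (IS k))).
(* [K i] is the number of the block containing [i]: the blocks exhaust the integers because
   [I 0 = 0] and [I] is strictly increasing. *)
have /choice[K HK] : forall i, exists k, (I k <= i < I k.+1)%N.
  elim=> [|i [k /andP[k1 k2]]].
    by exists 0; rewrite leqnn; exact: leq_ltn_trans (IS 0).
  have [ik|ik] := ltnP i.+1 (I k.+1); first by exists k; rewrite ltnW.
  by exists k.+1; rewrite ik (leq_ltn_trans _ (IS _)).
have KE i k : (I k <= i < I k.+1)%N -> K i = k.
  move=> /andP[k1 k2]; have /andP[k3 k4] := HK i.
  apply/eqP; rewrite eqn_leq; apply/andP; split; rewrite leqNgt; apply/negP.
    by move=> /Imono /(leq_trans k2) /leq_trans /(_ k3); rewrite ltnn.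
  by move=> /Imono /(leq_trans k4) /leq_trans /(_ k1); rewrite ltnn.
pose c i := c_ (n (K i)) i.
have Dcc i : D (c i) by exact: Dc.
have big k : e / 4 < `|F (n k) c|.
  (* An intermediate sequence: it differs from [c] only after block [k], and from [c_ (n k)] only
     before it, so each replacement costs at most [e / 4]. *)
  pose c' i := if (i < I k.+1)%N then c i else c_ (n k) i.
  have Dc' i : D (c' i) by rewrite /c'; case: ifP.
  have h1 : `|F (n k) c - F (n k) c'| <= e / 4.
    by apply: HM => // i iM; rewrite /c' (leq_trans iM).
  have h2 : `|F (n k) c' - F (n k) (c_ (n k))| <= e / 4.
    apply: (HN (I k)) => // i Ii; rewrite /c'; case: ifPn => // iI.
    by rewrite /c (KE i k) // Ii.
  have := nbad k.
  rewrite -[in F (n k) (c_ (n k))](subrK (F (n k) c) (F (n k) (c_ (n k)))).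
  move=> /lt_le_trans /(_ (ler_normD _ _)).
  have := ler_normD (F (n k) (c_ (n k)) - F (n k) c') (F (n k) c' - F (n k) c).
  rewrite addrA subrK [`|F (n k) (c_ (n k)) - F (n k) c'|]distrC.
  rewrite [`|F (n k) c' - F (n k) c|]distrC.
  by lra.
have /cvgr0Pnorm_le/(_ _ e4)[P _ HP] := F0 c Dcc.
have := HP (n P) (homo_ltn_geq_id nS P).
by rewrite leNgt big.
Qed.

(** * Functionals of signed-measure type and Schur's theorem *)

Section sigma_functional.
Context (R : realType) (T : topologicalType).
Implicit Types (g : T -> R) (S : set T) (l : (T -> R) -> R) (c : nat -> R)
  (h : nat -> T -> R).

Definition bounded_continuous g :=
  continuous g /\ exists C, forall x, `|g x| <= C.

(* What is used of integration against a finite signed measure carried by [S]: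
   linearity and dominated convergence, on bounded continuous functions. *)
Definition sigma_functional S l :=
  (forall a g1 g2, bounded_continuous g1 -> bounded_continuous g2 ->
    l (fun x => a * g1 x + g2 x) = a * l g1 + l g2) /\
  (forall C (g_ : nat -> T -> R), (forall n, continuous (g_ n)) ->
    (forall n x, `|g_ n x| <= C) ->
    (forall x, S x -> g_ n x @[n --> \oo] --> (0 : R)) ->
    l (g_ n) @[n --> \oo] --> (0 : R)).

(** The conditions under which every bounded coefficient sequence yields a bounded continuous sum:
    absolute sums are bounded uniformly, and tails are small locally uniformly. *)
Definition locally_summable h :=
  [/\ forall i, continuous (h i),
      exists C, forall x N, \sum_(0 <= i < N) `|h i x| <= C &
      forall (x : T) (e : R), 0 < e -> exists N,
        \forall y \near x, forall M, \sum_(N <= i < M) `|h i y| <= e].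

Definition weighted_sum c h x : R :=
  limn (fun n => \sum_(0 <= i < n) c i * h i x).

Lemma bounded_continuous_lin a g1 g2 : bounded_continuous g1 ->
  bounded_continuous g2 -> bounded_continuous (fun x => a * g1 x + g2 x).
Proof.
move=> [c1 [C1 b1]] [c2 [C2 b2]]; split.
  by move=> x; apply: cvgD; [apply: cvgM; [exact: cvg_cst|exact: c1]|exact: c2].
exists (`|a| * C1 + C2) => x; rewrite (le_trans (ler_normD _ _))//.
by rewrite lerD// normrM ler_wpM2l.
Qed.

Lemma bounded_continuous0 : bounded_continuous (fun=> 0).
Proof. by split; [exact: cst_continuous|exists 0 => x; rewrite normr0]. Qed.

Lemma bounded_continuous_sum (a : nat -> R) h N :
  (forall i, bounded_continuous (h i)) ->
  bounded_continuous (fun x => \sum_(0 <= i < N) a i * h i x).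
Proof.
move=> bh; elim: N => [|N IH].
  by under eq_fun do rewrite big_geq//; exact: bounded_continuous0.
under eq_fun do rewrite big_nat_recr//= addrC.
exact: bounded_continuous_lin.
Qed.

Section functional.
Variables (S : set T) (l : (T -> R) -> R).
Hypothesis hl : sigma_functional S l.

Lemma sigma_functional0 : l (fun=> 0) = 0.
Proof.
have := hl.1 1 _ _ bounded_continuous0 bounded_continuous0.
under eq_fun do rewrite mulr0 addr0.
by rewrite mul1r => /eqP; rewrite -subr_eq subrr => /eqP.
Qed.

Lemma sigma_functional_sum (a : nat -> R) h N :
  (forall i, bounded_continuous (h i)) ->
  l (fun x => \sum_(0 <= i < N) a i * h i x) = \sum_(0 <= i < N) a i * l (h i).
Proof.
move=> bh; elim: N => [|N IH].
  rewrite big_geq//; under eq_fun do rewrite big_geq//.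
  exact: sigma_functional0.
under eq_fun do rewrite big_nat_recr//= addrC.
rewrite hl.1//; last exact: bounded_continuous_sum.
by rewrite IH big_nat_recr//= addrC.
Qed.

Lemma sigma_functionalB g1 g2 : bounded_continuous g1 -> bounded_continuous g2 ->
  l (fun x => g1 x - g2 x) = l g1 - l g2.
Proof.
move=> b1 b2; under eq_fun do rewrite addrC -mulN1r.
by rewrite hl.1// mulN1r addrC.
Qed.

(** The constant sequence [g1 - g2] is bounded and tends to zero on [S], so dominated convergence
    forces its constant value under [l] to be zero. *)
Lemma sigma_functional_eq g1 g2 : bounded_continuous g1 ->
  bounded_continuous g2 -> {in S, g1 =1 g2} -> l g1 = l g2.
Proof.
move=> b1 b2 e12; apply/eqP; rewrite -subr_eq0 -sigma_functionalB//; apply/eqP.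
have [c [C b]] := bounded_continuous_lin (-1) b2 b1.
have E : (fun x => g1 x - g2 x) = (fun x => -1 * g2 x + g1 x).
  by apply/funext => x; rewrite mulN1r addrC.
have /= L : l (fun x => g1 x - g2 x) @[n --> \oo] --> (0 : R).
  apply: (hl.2 C (fun n x => g1 x - g2 x)).
  - by move=> _; rewrite E.
  - by move=> _ x; have := b x; rewrite mulN1r addrC.
  - by move=> x Sx; rewrite e12 ?inE// subrr; exact: cvg_cst.
exact: (cvg_unique (@Rhausdorff R) (cvg_cst _) L).
Qed.

End functional.

Section weighted_sum.
Variable h : nat -> T -> R.
Hypothesis hh : locally_summable h.

Lemma is_cvg_weighted_sum c B x : (forall i, `|c i| <= B) ->
  cvgn (fun n => \sum_(0 <= i < n) c i * h i x).
Proof.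
move=> cB; have [_ [C HC] _] := hh.
apply: (@normed_cvg _ _ (fun i => c i * h i x)).
apply: nondecreasing_is_cvgn.
  by apply: nondecreasing_series => i _ _; exact: normr_ge0.
exists (B * C) => _ [n _ <-]; rewrite /series /=.
have B0 : 0 <= B := le_trans (normr_ge0 _) (cB 0%N).
apply: le_trans (ler_wpM2l B0 (HC x n)).
rewrite mulr_sumr ler_sum// => i _; rewrite normrM.
by rewrite ler_wpM2r.
Qed.

(** The bound passes to the limit from the finite sums; with [N = 0] it bounds the whole sum. *)
Lemma weighted_sum_tail c B x N e : (forall i, `|c i| <= B) ->
  (forall M, \sum_(N <= i < M) `|h i x| <= e) ->
  `|weighted_sum c h x - \sum_(0 <= i < N) c i * h i x| <= B * e.
Proof.
move=> cB He.
have B0 : 0 <= B := le_trans (normr_ge0 _) (cB 0%N).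
have cv : `|(\sum_(0 <= i < n) c i * h i x) - \sum_(0 <= i < N) c i * h i x|
    @[n --> \oo] --> `|weighted_sum c h x - \sum_(0 <= i < N) c i * h i x|.
  apply: cvg_norm; apply: cvgB; last exact: cvg_cst.
  exact: is_cvg_weighted_sum cB.
rewrite -(cvg_lim _ cv)//; apply: limr_le; first by apply/cvg_ex; eexists; exact: cv.
exists N => // n /= Nn.
rewrite (big_cat_nat (leq0n N) Nn)//= addrAC subrr add0r.
apply: le_trans (ler_norm_sum _ _ _) _.
apply: le_trans (ler_wpM2l B0 (He n)).
rewrite mulr_sumr ler_sum// => i _; rewrite normrM.
by rewrite ler_wpM2r.
Qed.

Lemma bounded_continuous_summand i : bounded_continuous (h i).
Proof.
have [c [C HC] _] := hh; split=> //; exists C => x.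
apply: le_trans (HC x i.+1); rewrite big_nat_recr//= lerDr.
by rewrite sumr_ge0.
Qed.

Lemma bounded_continuous_weighted_sum c B : (forall i, `|c i| <= B) ->
  bounded_continuous (weighted_sum c h).
Proof.
move=> cB; have [ch [C HC] Hl] := hh.
have B0 : 0 <= B := le_trans (normr_ge0 _) (cB 0%N).
split; last first.
  exists (B * C) => x; have := weighted_sum_tail cB (HC x).
  by rewrite big_geq// subr0.
move=> x; apply/cvgrPdist_le => e e0.
have B1 : 0 < B + 1 by rewrite ltr_wpDl.
have e1 : 0 < e / 3 / (B + 1) by rewrite !divr_gt0.
have [N HN] := Hl x _ e1.
have [cN _] := bounded_continuous_sum c N bounded_continuous_summand.
have /cvgrPdist_le/(_ (e / 3)) cx := cN x.
have {}cx := cx (divr_gt0 e0 (ltr0n _ 3)).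
have Be : B * (e / 3 / (B + 1)) <= e / 3.
  rewrite mulrCA ger_pMr ?divr_gt0//.
  by rewrite ler_pdivrMr// mul1r lerDl.
near=> y.
have hx := le_trans (weighted_sum_tail cB (nbhs_singleton HN)) Be.
have hy : `|weighted_sum c h y - \sum_(0 <= i < N) c i * h i y| <= e / 3.
  apply: (le_trans (weighted_sum_tail cB _) Be).
  by near: y.
have hxy : `|\sum_(0 <= i < N) c i * h i x - \sum_(0 <= i < N) c i * h i y|
    <= e / 3 by near: y.
move: hx hy hxy; rewrite !ler_norml; lra.
Unshelve. all: by end_near. Qed.

Lemma weighted_sumB c1 c2 B1 B2 : (forall i, `|c1 i| <= B1) ->
  (forall i, `|c2 i| <= B2) ->
  (fun x => weighted_sum c1 h x - weighted_sum c2 h x) =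
  weighted_sum (fun i => c1 i - c2 i) h.
Proof.
move=> b1 b2; apply/funext => x; rewrite /weighted_sum.
rewrite -limB; [|exact: is_cvg_weighted_sum b1|exact: is_cvg_weighted_sum b2].
congr (limn _); apply/funext => n /=.
by rewrite fctE -sumrB; apply: eq_bigr => i _; rewrite mulrBl.
Qed.

Lemma weighted_sum_finite c N x : (forall i, (N <= i)%N -> c i = 0) ->
  weighted_sum c h x = \sum_(0 <= i < N) c i * h i x.
Proof.
move=> c0; apply: lim_near_cst => //; exists N => // n /= Nn.
rewrite (big_cat_nat (leq0n N) Nn)//= [X in _ + X]big_nat [X in _ + X]big1 ?addr0//.
by move=> i /andP[Ni _]; rewrite c0// mul0r.
Qed.

End weighted_sum.

(** The coefficients range over the unit ball of l^oo and are paired with the sequences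
    [l_ n (h i)]. Weak nullity is tested on every fixed [c], and [gliding_hump] lets [c] depend on
    [n]. *)
Lemma schur S (l_ : nat -> (T -> R) -> R) h (c_ : nat -> nat -> R) :
  (forall n, sigma_functional S (l_ n)) ->
  (forall g, bounded_continuous g -> l_ n g @[n --> \oo] --> (0 : R)) ->
  locally_summable h -> (forall n i, `|c_ n i| <= 1) ->
  l_ n (weighted_sum (c_ n) h) @[n --> \oo] --> (0 : R).
Proof.
move=> hl l0 hh c1; have [_ [C HC] Hl] := hh.
have bc c : (forall i, `|c i| <= 1) -> bounded_continuous (weighted_sum c h).
  exact: bounded_continuous_weighted_sum.
have diff2 (c c' : nat -> R) : (forall i, `|c i| <= 1) ->
    (forall i, `|c' i| <= 1) -> forall i, `|c i - c' i| <= 2.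
  by move=> b b' i; move: (b i) (b' i); rewrite !ler_norml; lra.
apply: (@gliding_hump R R [set t | `|t| <= 1]
  (fun n c => l_ n (weighted_sum c h))) => //=.
- by move=> c cb; apply: l0; exact: bc.
(* Tail condition. Otherwise there are bad pairs agreeing below each [M]; the sums of their
   differences are bounded by [2 * C] and tend to zero pointwise, against dominated convergence. *)
- move=> n e e0; apply: contrapT => H.
  have /choice[cc Hcc] : forall M, exists p : (nat -> R) * (nat -> R),
      [/\ forall i, `|p.1 i| <= 1, forall i, `|p.2 i| <= 1,
       forall i, (i < M)%N -> p.1 i = p.2 i &
       e < `|l_ n (weighted_sum p.1 h) - l_ n (weighted_sum p.2 h)|].
    move=> M; apply: contrapT => K; apply: H; exists M => c c' b b' eq.
    by rewrite leNgt; apply/negP => ?; apply: K; exists (c, c').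
  pose d M i := (cc M).1 i - (cc M).2 i.
  have d2 M i : `|d M i| <= 2 by have [b b' _ _] := Hcc M; exact: diff2.
  have : l_ n (weighted_sum (d M) h) @[M --> \oo] --> (0 : R).
    apply: (hl n).2 (2 * C) _ _ _ _.
    + by move=> M; exact: (bounded_continuous_weighted_sum hh (d2 M)).1.
    + move=> M x; have := weighted_sum_tail hh (d2 M) (HC x).
      by rewrite [X in _ - X]big_geq// subr0.
    + move=> x _; apply/cvgr0Pnorm_le => r r0.
      have r2 : 0 < r / 2 by rewrite divr_gt0.
      have [N /nbhs_singleton HN] := Hl x _ r2.
      exists N => // M /= NM.
      have HM M' : \sum_(M <= i < M') `|h i x| <= r / 2.
        have [MM'|/ltnW M'M] := leqP M M'; last by rewrite big_geq// ltW.
        apply: le_trans (HN M').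
        by rewrite (big_cat_nat NM MM')//= lerDr sumr_ge0.
      have := weighted_sum_tail hh (d2 M) HM.
      rewrite [X in _ - X]big_nat big1 ?subr0; last first.
        move=> i /andP[_ iM]; have [_ _ eq _] := Hcc M.
        by rewrite /d eq// subrr mul0r.
      by rewrite mulrCA divff// mulr1.
  move/cvgr0Pnorm_le/(_ _ e0)=> [N _ HN].
  have [b b' _] := Hcc N; rewrite ltNge => /negP; apply.
  apply: le_trans (HN N (leqnn N)).
  by rewrite -(sigma_functionalB (hl n)) ?(weighted_sumB hh b b')//; exact: bc.
(* Head condition. The difference is a combination of [h 0], ..., [h (M - 1)] with coefficients of
   size at most 2, and [l_ n] tends to zero on each of these finitely many functions. *)
- move=> M e e0.
  have : 2 * \sum_(0 <= i < M) `|l_ n (h i)| @[n --> \oo] --> (2 * 0 : R).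
    apply: cvgM; first exact: cvg_cst.
    elim: M => [|M IH].
      by under eq_fun do rewrite big_geq//; exact: cvg_cst.
    under eq_fun do rewrite big_nat_recr//=.
    have := cvg_norm (l0 _ (bounded_continuous_summand hh M)).
    rewrite normr0 => lM; have := cvgD IH (lM eventually_filter).
    by rewrite addr0; exact.
  rewrite mulr0 => /cvgr0Pnorm_le/(_ _ e0)[N _ HN]; exists N.
  move=> n c c' Nn b b' eq.
  rewrite -(sigma_functionalB (hl n)); [|exact: bc|exact: bc].
  rewrite (weighted_sumB hh b b').
  rewrite (_ : weighted_sum _ h =
      fun x => \sum_(0 <= i < M) (c i - c' i) * h i x); last first.
    apply/funext => x; apply: weighted_sum_finite => i Mi.
    by rewrite eq// subrr.
  rewrite (sigma_functional_sum (hl n)); last exact: bounded_continuous_summand.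
  apply: le_trans (HN n Nn); apply: le_trans (ler_norm_sum _ _ _) _.
  apply: le_trans (ler_norm _).
  rewrite mulr_sumr ler_sum// => i _; rewrite normrM ler_wpM2r//.
  exact: diff2.
Qed.

End sigma_functional.

(** * Truncation of real functions *)

Section clamp.
Context (R : realType).
Implicit Types a b s t : R.

Definition clamp a b t := Num.max a (Num.min b t).

Lemma clamp_itv a b t : a <= b -> a <= clamp a b t <= b.
Proof. by rewrite /clamp /Num.max /Num.min; repeat case: ifPn; lra. Qed.

Lemma clamp_id a b t : a <= t <= b -> clamp a b t = t.
Proof. by rewrite /clamp /Num.max /Num.min; repeat case: ifPn; lra. Qed.

Lemma clamp_le a b t : a <= b -> t <= a -> clamp a b t = a.
Proof. by rewrite /clamp /Num.max /Num.min; repeat case: ifPn; lra. Qed.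

Lemma clamp_ge a b t : a <= b -> b <= t -> clamp a b t = b.
Proof. by rewrite /clamp /Num.max /Num.min; repeat case: ifPn; lra. Qed.

Lemma clamp_lipschitz a b s t : `|clamp a b s - clamp a b t| <= `|s - t|.
Proof.
have [st|ts] := leP t s.
  rewrite [leRHS]ger0_norm ?subr_ge0//.
  rewrite ler_norml /clamp /Num.max /Num.min; repeat case: ifPn; lra.
rewrite [leRHS]ltr0_norm ?subr_lt0//.
by rewrite ler_norml /clamp /Num.max /Num.min; repeat case: ifPn; lra.
Qed.

Lemma continuous_clamp a b (T : topologicalType) (g : T -> R) :
  continuous g -> continuous (fun x => clamp a b (g x)).
Proof.
move=> cg x; apply/cvgrPdist_le => e e0.
have /cvgrPdist_le/(_ _ e0) := cg x; apply: filterS => y.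
exact/le_trans/clamp_lipschitz.
Qed.

Lemma clamp_norm b t : 0 <= b -> `|clamp (- b) b t| <= b.
Proof. by move=> b0; rewrite ler_norml clamp_itv// ge0_cp. Qed.

End clamp.

(** * Consequences of Schur's theorem for weakly null functionals *)

Section weakly_null_functionals.
Context (R : realType) (T : topologicalType) (S : set T).
Variable l_ : nat -> (T -> R) -> R.
Hypothesis hl : forall n, sigma_functional S (l_ n).
Hypothesis l0 : forall g, bounded_continuous g -> l_ n g @[n --> \oo] --> (0 : R).

Lemma weighted_sumZ (h : nat -> T -> R) (c : nat -> R) B (K : R) :
  locally_summable h -> (forall i, `|c i| <= B) ->
  weighted_sum (fun i => K * c i) h = (fun x => K * weighted_sum c h x).
Proof.
move=> hh cB; apply/funext => x; rewrite /weighted_sum.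
apply: cvg_lim => //.
under eq_fun do (under eq_bigr do rewrite -mulrA; rewrite -mulr_sumr).
by apply: cvgM; [exact: cvg_cst|exact: is_cvg_weighted_sum cB].
Qed.

Lemma schur_scale (h : nat -> T -> R) (c_ : nat -> nat -> R) B :
  locally_summable h -> (forall n i, `|c_ n i| <= B) ->
  l_ n (weighted_sum (c_ n) h) @[n --> \oo] --> (0 : R).
Proof.
move=> hh cB.
have B0 : 0 <= B := le_trans (normr_ge0 _) (cB 0%N 0%N).
have B1 : 0 < B + 1 by rewrite ltr_wpDl.
(* The scaling is by [B + 1], which is invertible even when [B] is zero. *)
pose c' n i := (B + 1)^-1 * c_ n i.
have c'1 n i : `|c' n i| <= 1.
  rewrite normrM gtr0_norm ?invr_gt0// mulrC ler_pdivrMr// mul1r.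
  by rewrite (le_trans (cB n i))// lerDl.
have E n : l_ n (weighted_sum (c_ n) h) = (B + 1) * l_ n (weighted_sum (c' n) h).
  rewrite (_ : weighted_sum _ _ =
      fun x => (B + 1) * weighted_sum (c' n) h x + 0); last first.
    under [RHS]eq_fun do rewrite addr0.
    rewrite -(weighted_sumZ _ hh (c'1 n)); congr weighted_sum.
    by apply/funext => i; rewrite /c' mulrA divff ?mul1r// gt_eqF.
  rewrite (hl n).1; last 2 first.
  - exact: bounded_continuous_weighted_sum (c'1 n).
  - exact: bounded_continuous0.
  by rewrite (sigma_functional0 (hl n)) addr0.
under eq_fun do rewrite E.
suff : (B + 1) * l_ n (weighted_sum (c' n) h) @[n --> \oo] --> ((B + 1) * 0 : R).
  by rewrite mulr0.
by apply: cvgM; [exact: cvg_cst|exact: schur hl l0 hh c'1].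
Qed.

Lemma sum_half_le N M : \sum_(N <= i < M) (2^-1 : R) ^+ i <= 2 * 2^-1 ^+ N.
Proof.
have [MN|/ltnW NM] := leqP M N; first by rewrite big_geq// mulr_ge0// exprn_ge0.
suff -> : \sum_(N <= i < M) (2^-1 : R) ^+ i = 2 * 2^-1 ^+ N - 2 * 2^-1 ^+ M.
  by rewrite gerBl mulr_ge0// exprn_ge0.
elim: M NM => [|M IH]; first by rewrite leqn0 => /eqP ->; rewrite big_geq// subrr.
rewrite leq_eqVlt => /predU1P[->|]; first by rewrite big_geq// subrr.
by rewrite ltnS => NM; rewrite big_nat_recr//= IH// exprS; field.
Qed.

(** The geometric bound makes [g_] itself locally summable, and [g_ n] is its weighted sum with the
    [n]-th unit vector as coefficients, so Schur's theorem applies. *)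
Lemma sigma_functional_dyadic (g_ : nat -> T -> R) :
  (forall n, continuous (g_ n)) -> (forall n x, `|g_ n x| <= 2^-1 ^+ n) ->
  l_ n (g_ n) @[n --> \oo] --> (0 : R).
Proof.
move=> cg gb.
have hg : locally_summable g_.
  split => //.
    exists (2 * 2^-1 ^+ 0) => x N; apply: le_trans (sum_half_le 0 N).
    exact: ler_sum.
  move=> x e e0.
  have : (2 * 2^-1 ^+ n : R) @[n --> \oo] --> (2 * 0 : R).
    apply: cvgM; first exact: cvg_cst.
    by apply: cvg_expr; rewrite ger0_norm// invf_lt1// ltr1n.
  rewrite mulr0 => /cvgr0Pnorm_le/(_ _ e0)[N _ HN]; exists N.
  apply: nearW => y M; apply: le_trans (HN N (leqnn N)).
  apply: le_trans (ler_norm _); apply: le_trans (sum_half_le N M).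
  exact: ler_sum.
have d1 (n i : nat) : `|(i == n)%:R : R| <= 1.
  by case: eqP; rewrite ?normr1 ?normr0.
have := schur hl l0 hg d1.
apply: cvg_trans; apply: near_eq_cvg; apply: nearW => n.
congr (l_ n _); apply/funext => x.
rewrite (@weighted_sum_finite _ _ _ _ n.+1); last first.
  by move=> i; case: eqP => // ->; rewrite ltnn.
rewrite big_nat_recr//= eqxx mul1r big_nat big1 ?add0r//.
by move=> i /andP[_ ni]; rewrite lt_eqF// mul0r.
Qed.

End weakly_null_functionals.

(** * Countable partitions of unity for a continuous pseudometric *)

Section partition_of_unity.
Context (R : realType) (T : topologicalType).

Definition continuous_pseudometric (d : T -> T -> R) :=
  [/\ forall x, d x x = 0, forall x y, d x y = d y x,
      forall x y z, d x z <= d x y + d y z & forall a, continuous (d ^~ a)].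

(** The [d]-closure of the range of [x_], hence a [d]-separable set. *)
Definition accessible (d : T -> T -> R) (x_ : nat -> T) :=
  [set x | forall e, 0 < e -> exists i, d x (x_ i) < e].

(** Stick breaking: each [psi i] takes its share of what the earlier ones have left. *)
Lemma telescope_prod (psi : nat -> R) N :
  \sum_(0 <= i < N) psi i * \prod_(0 <= j < i) (1 - psi j) =
  1 - \prod_(0 <= j < N) (1 - psi j).
Proof.
elim: N => [|N IH]; first by rewrite !big_geq// subrr.
by rewrite big_nat_recr//= IH [in RHS]big_nat_recr//=; ring.
Qed.

Variables (d : T -> T -> R) (x_ : nat -> T).
Hypothesis dP : continuous_pseudometric d.

Lemma pseudometric_ge0 x y : 0 <= d x y.
Proof.
have [d0 dC dD _] := dP; have := dD x y x; rewrite d0 (dC y x); lra.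
Qed.

Let D x := inf (range (fun i => d x (x_ i))).

Let D_lb x i : D x <= d x (x_ i).
Proof.
apply: ge_inf; last by exists i.
by exists 0 => _ [j _ <-]; exact: pseudometric_ge0.
Qed.

Let D_glb x a : (forall i, a <= d x (x_ i)) -> a <= D x.
Proof.
move=> H; apply: lb_le_inf; first by exists (d x (x_ 0%N)), 0%N.
by move=> _ [j _ <-].
Qed.

Let continuous_D : continuous D.
Proof.
have [d0 dC dD dc] := dP.
have lip x y : D x - D y <= d x y.
  rewrite lerBlDr -lerBlDl; apply: D_glb => i; rewrite lerBlDl.
  exact: le_trans (D_lb x i) (dD _ _ _).
move=> x; apply/cvgrPdist_le => e e0.
have /cvgrPdist_le/(_ _ e0) := dc x x; apply: filterS => y.
rewrite d0 sub0r normrN ger0_norm ?pseudometric_ge0// => dyx.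
have := lip x y; have := lip y x; rewrite (dC x y) ler_norml; lra.
Qed.

(* The infimum [D] of the distances to the centers cuts the bumps off before
   they leave the region where finitely many of them suffice. *)
Lemma partition_of_unity e : 0 < e -> exists h : nat -> T -> R,
  [/\ locally_summable h, forall i x, 0 <= h i x,
      forall N x, \sum_(0 <= i < N) h i x <= 1,
      forall i x, h i x != 0 -> d x (x_ i) <= e &
      forall x, accessible d x_ x ->
        \sum_(0 <= i < N) h i x @[N --> \oo] --> (1 : R)].
Proof.
move=> e0; have [d0 dC dD dc] := dP.
(* [psi j] is 1 within [e / 2] of [x_ j] and 0 from distance [e] on; [chi] is 1 where [D <= e / 4]
   and 0 where [D >= e / 2]. So wherever [chi] is nonzero some [psi j] equals 1, which kills all
   later bumps. *)
pose psi j x := clamp 0 1 (2 - 2 / e * d x (x_ j)).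
pose chi x := clamp 0 1 (2 - 4 / e * D x).
pose h i x := chi x * (psi i x * \prod_(0 <= j < i) (1 - psi j x)).
have psi01 j x : 0 <= psi j x <= 1 by exact: clamp_itv.
have chi01 x : 0 <= chi x <= 1 by exact: clamp_itv.
have prod01 N x : 0 <= \prod_(0 <= j < N) (1 - psi j x) <= 1.
  apply/andP; split.
    by apply: prodr_ge0 => j _; have := psi01 j x; lra.
  by apply: prodr_ile1 => j _; have := psi01 j x; lra.
have h0 i x : 0 <= h i x.
  have /andP[? _] := psi01 i x; have /andP[? _] := chi01 x.
  by have /andP[? _] := prod01 i x; rewrite /h !mulr_ge0.
have sumh N x : \sum_(0 <= i < N) h i x =
    chi x * (1 - \prod_(0 <= j < N) (1 - psi j x)).
  by rewrite -telescope_prod mulr_sumr.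
have sumh1 N x : \sum_(0 <= i < N) h i x <= chi x.
  by rewrite sumh ler_piMr//; [case/andP: (chi01 x)|have := prod01 N x; lra].
have cpsi j : continuous (psi j).
  apply: continuous_clamp => x; apply: cvgB; first exact: cvg_cst.
  by apply: cvgM; [exact: cvg_cst|exact: dc].
have cchi : continuous chi.
  apply: continuous_clamp => x; apply: cvgB; first exact: cvg_cst.
  by apply: cvgM; [exact: cvg_cst|exact: continuous_D].
have ch i : continuous (h i).
  move=> x; apply: cvgM; first exact: cchi.
  apply: cvgM; first exact: cpsi.
  elim: i => [|i IH].
    by under eq_fun do rewrite big_geq//; rewrite big_geq//; exact: cvg_cst.
  under eq_fun do rewrite big_nat_recr//=; rewrite big_nat_recr//=.
  by apply: cvgM => //; apply: cvgB; [exact: cvg_cst|exact: cpsi].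
have psi1 j x : d x (x_ j) <= e / 2 -> psi j x = 1.
  move=> dj; apply: clamp_ge => //; rewrite lerBrDl -lerBrDr.
  have := ler_wpM2l (ltW (divr_gt0 (ltr0n R 2) e0)) dj.
  by rewrite mulrA divfK ?gt_eqF// divff//; lra.
have h_vanish j i x : psi j x = 1 -> (j < i)%N -> h i x = 0.
  move=> pj ji; rewrite /h (big_cat_nat (leq0n j) (ltnW ji))//=.
  by rewrite [X in _ * (_ * (_ * X))]big_ltn// pj subrr mul0r !mulr0.
exists h; split => //.
- split => //.
    exists 1 => x N; under eq_bigr do rewrite ger0_norm//.
    by rewrite (le_trans (sumh1 _ _))//; case/andP: (chi01 x).
  move=> x r r0.
  (* If [D x < e / 2], one center is within [e / 2] of all points near [x], and the tail vanishes
     there. Otherwise [chi x = 0], and the whole sum, being at most [chi], is small near [x]. *)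
  have [Dx|Dx] := ltP (D x) (e / 2).
    have [j dj] : exists j, d x (x_ j) < e / 2.
      apply: contrapT => H; move: Dx; rewrite ltNge => /negP; apply.
      by apply: D_glb => i; rewrite leNgt; apply/negP => ?; apply: H; exists i.
    exists j.+1; have : \forall y \near x, d y (x_ j) < e / 2.
      exact: (cvgr_lt (d x (x_ j))  (dc _ _)).
    apply: filterS => y /ltW/psi1 pj M.
    rewrite big_nat big1 ?ltW// => i /andP[ji _].
    by rewrite (h_vanish j)// normr0.
  have chix : chi x = 0.
    apply: clamp_le => //; rewrite subr_le0.
    have := ler_wpM2l (ltW (divr_gt0 (ltr0n R 4) e0)) Dx.
    by rewrite mulrA divfK ?gt_eqF//; lra.
  exists 0%N; have /cvgrPdist_le/(_ _ r0) := cchi x; apply: filterS => y.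
  rewrite chix sub0r normrN => chiy M.
  under eq_bigr do rewrite ger0_norm//.
  exact: le_trans (sumh1 _ _) (le_trans (ler_norm _) chiy).
- by move=> N x; rewrite (le_trans (sumh1 N x))//; case/andP: (chi01 x).
- move=> i x; apply: contraNT; rewrite -ltNge => /ltW ed.
  rewrite /h /psi [clamp _ _ _]clamp_le ?mul0r ?mulr0//.
  rewrite subr_le0; have := ler_wpM2l (ltW (divr_gt0 (ltr0n R 2) e0)) ed.
  by rewrite divfK ?gt_eqF.
- move=> x Ax; have [j dj] := Ax _ (divr_gt0 e0 (ltr0n R 2)).
  have Dx : D x <= 0.
    apply/ler_addgt0Pl => r r0; rewrite addr0.
    by have [i /ltW] := Ax r r0; exact: le_trans (D_lb x i).
  have chix : chi x = 1.
    apply: clamp_ge => //.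
    have : 4 / e * D x <= 0 by rewrite pmulr_rle0// divr_gt0.
    lra.
  apply: cvg_near_cst; exists j.+1 => // N /= jN.
  rewrite sumh chix mul1r (big_cat_nat (leq0n j) (ltnW jN))//=.
  by rewrite [X in _ * X]big_ltn// psi1 ?ltW// subrr mul0r mulr0 subr0.
Qed.

End partition_of_unity.

(** * Uniform convergence on bounded 1-Lipschitz functions *)

Section uniform_equicontinuous.
Context (R : realType) (T : topologicalType).
Variables (d : T -> T -> R) (x_ : nat -> T).
Hypothesis dP : continuous_pseudometric d.

Lemma continuous_lipschitz (f : T -> R) :
  (forall x y, `|f x - f y| <= d x y) -> continuous f.
Proof.
move=> fd x; have [d0 dC dD dc] := dP; apply/cvgrPdist_le => e e0.
have /cvgrPdist_le/(_ _ e0) := dc x x; apply: filterS => y.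
rewrite d0 sub0r normrN dC; apply: le_trans.
exact: le_trans (fd x y) (ler_norm _).
Qed.

(** As the bumps sum to 1 at [x], the error is an average of the differences [f x - f (x_ i)], taken
    only over centers within [e] of [x]. *)
Lemma weighted_sum_approx (h : nat -> T -> R) (f : T -> R) B e x :
  locally_summable h -> (forall i x, 0 <= h i x) ->
  (forall N x, \sum_(0 <= i < N) h i x <= 1) ->
  (forall i x, h i x != 0 -> d x (x_ i) <= e) ->
  \sum_(0 <= i < N) h i x @[N --> \oo] --> (1 : R) ->
  0 <= e -> (forall x y, `|f x - f y| <= d x y) -> (forall x, `|f x| <= B) ->
  `|f x - weighted_sum (fun i => f (x_ i)) h x| <= e.
Proof.
move=> hh h0 h1 hd hx e0 fd fB.
have cv : `|f x * (\sum_(0 <= i < N) h i x) - \sum_(0 <= i < N) f (x_ i) * h i x|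
    @[N --> \oo] --> `|f x * 1 - weighted_sum (fun i => f (x_ i)) h x|.
  apply: cvg_norm; apply: cvgB; first by apply: cvgM => //; exact: cvg_cst.
  by apply: (@is_cvg_weighted_sum _ _ _ hh _ B).
rewrite -[f x]mulr1 -(cvg_lim _ cv)//; apply: limr_le.
  by apply/cvg_ex; eexists; exact: cv.
apply: nearW => N; rewrite mulr_sumr -sumrB.
apply: le_trans (ler_norm_sum _ _ _) _.
apply: le_trans (ler_piMr e0 (h1 N x)); rewrite mulr_sumr ler_sum// => i _.
rewrite -mulrBl normrM [X in _ * X]ger0_norm//.
have [->|hi] := eqVneq (h i x) 0; first by rewrite !mulr0.
by rewrite ler_wpM2r// (le_trans (fd _ _))// hd.
Qed.

Lemma sigma_functional_equicontinuous (l_ : nat -> (T -> R) -> R)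
    (f_ : nat -> T -> R) B :
  (forall n, sigma_functional (accessible d x_) (l_ n)) ->
  (forall g, bounded_continuous g -> l_ n g @[n --> \oo] --> (0 : R)) ->
  (forall n x y, `|f_ n x - f_ n y| <= d x y) -> (forall n x, `|f_ n x| <= B) ->
  l_ n (f_ n) @[n --> \oo] --> (0 : R).
Proof.
move=> hl l0 fd fB; apply: contrapT => /not_cvg0_frequently[e e0 bad].
have bf n : bounded_continuous (f_ n).
  by split; [exact: continuous_lipschitz|exists B].
have half0 k : 0 < (2^-1 : R) ^+ k by rewrite exprn_gt0.
have /choice[h_ h_P] := fun k => partition_of_unity x_ dP (half0 k).
pose P k n := weighted_sum (fun i => f_ n (x_ i)) (h_ k).
have bP k n : bounded_continuous (P k n).
  have [hh _ _ _ _] := h_P k.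
  exact: (bounded_continuous_weighted_sum hh (fun i => fB n (x_ i))).
(* At mesh [2^-1 ^+ k], [schur_scale] gives a bad index at which the approximating sum accounts for
   at most half of [e]; the remainder has to account for the rest. *)
have /choice[n_ n_P] : forall k, exists n, [/\ (k <= n)%N, e < `|l_ n (f_ n)| &
    `|l_ n (P k n)| <= e / 2].
  move=> k; have [hh _ _ _ _] := h_P k.
  have := schur_scale hl l0 hh (fun n i => fB n (x_ i)).
  move=> /cvgr0Pnorm_le/(_ _ (divr_gt0 e0 (ltr0n R 2)))[N _ HN].
  have [n] := bad (maxn k N); rewrite geq_max => /andP[kn Nn] en.
  by exists n; split => //; exact: HN.
(* The remainder is known to be small only on the accessible set. Clamping makes it small everywhere
   and, by [sigma_functional_eq], does not change its value under [l_ (n_ k)]. *)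
pose g k x := clamp (- 2^-1 ^+ k) (2^-1 ^+ k) (f_ (n_ k) x - P k (n_ k) x).
have gb k x : `|g k x| <= 2^-1 ^+ k by rewrite clamp_norm// ltW.
have cg k : continuous (g k).
  apply: continuous_clamp => x.
  by apply: cvgB; [exact: (bf _).1|exact: (bP _ _).1].
have lg k : l_ (n_ k) (g k) = l_ (n_ k) (f_ (n_ k)) - l_ (n_ k) (P k (n_ k)).
  rewrite -(sigma_functionalB (hl _)) //.
  apply: (sigma_functional_eq (hl _)).
  - by split=> //; exists (2^-1 ^+ k).
  - have := bounded_continuous_lin (-1) (bP k (n_ k)) (bf (n_ k)).
    by under eq_fun do rewrite mulN1r addrC.
  - move=> x; rewrite inE => Sx; rewrite /g clamp_id// -ler_norml.
    have [hh h0 h1 hd hx] := h_P k.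
    by apply: (weighted_sum_approx hh h0 h1 hd (hx x Sx)) => //; rewrite ltW.
have n_oo : n_ k @[k --> \oo] --> \oo.
  move=> A [N _ NA]; exists N => // k /= Nk; apply: NA => /=.
  by have [kn _ _] := n_P k; exact: leq_trans kn.
have := @sigma_functional_dyadic R T _ (fun k => l_ (n_ k)) (fun k => hl (n_ k))
  (fun g bg => cvg_comp _ _ n_oo (l0 g bg)) g cg gb.
move=> /cvgr0Pnorm_le/(_ _ (divr_gt0 e0 (ltr0n R 2)))[N _ HN].
have := HN N (leqnn N); have [_ bN PN] := n_P N; rewrite lg.
move=> H; have := ler_normD (l_ (n_ N) (f_ (n_ N)) - l_ (n_ N) (P N (n_ N)))
  (l_ (n_ N) (P N (n_ N))).
rewrite subrK; lra.
Qed.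

End uniform_equicontinuous.

(** * The Hahn-Banach theorem through minimal sublinear functionals *)

Section hahn_banach.
Context (R : realType) (X : lmodType R).
Implicit Types p : X -> R.

Definition sublinear p :=
  (forall x y, p (x + y) <= p x + p y) /\
  (forall a x, 0 <= a -> p (a *: x) = a * p x).

Lemma sublinear0 p : sublinear p -> p 0 = 0.
Proof. by move=> [_ /(_ 0 0 (lexx 0))]; rewrite scale0r mul0r. Qed.

Lemma sublinear_opp p x : sublinear p -> - p (- x) <= p x.
Proof.
by move=> sp; have := sp.1 x (- x); rewrite subrr sublinear0//; lra.
Qed.

Lemma sublinear_homo p : (forall a x, 0 < a -> p (a *: x) <= a * p x) ->
  p 0 = 0 -> forall a x, 0 <= a -> p (a *: x) = a * p x.
Proof.
move=> pZ p0 a x; rewrite le_eqVlt => /predU1P[<-|a0].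
  by rewrite scale0r mul0r.
apply/eqP; rewrite eq_le pZ//= mulrC -ler_pdivlMr// mulrC.
have ai : 0 < a^-1 by rewrite invr_gt0.
apply: le_trans (pZ _ (a *: x) ai).
by rewrite scalerA mulVf ?scale1r// gt_eqF.
Qed.

Section slope.
Variables (p : X -> R) (y : X).
Hypothesis sp : sublinear p.

Let A x := [set p (x + t *: y) - t * p y | t in [set t : R | 0 <= t]].

(* [slope] is a sublinear minorant of [p] with value at most [- p y] at [- y].
   A minimal sublinear [p] thus equals its slopes, and this makes it linear. *)
Definition slope x := inf (A x).

Let A_lb x : lbound (A x) (- p (- x)).
Proof.
move=> _ [t /= t0 <-].
have := sp.1 (x + t *: y) (- x); rewrite addrAC subrr add0r sp.2//; lra.
Qed.

Let slope_le x t : 0 <= t -> slope x <= p (x + t *: y) - t * p y.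
Proof. by move=> t0; apply: ge_inf; [exists (- p (- x)); exact: A_lb|exists t]. Qed.

Let slope_glb x a : (forall t, 0 <= t -> a <= p (x + t *: y) - t * p y) ->
  a <= slope x.
Proof.
move=> H; apply: lb_le_inf.
  by exists (p (x + 0 *: y) - 0 * p y); exists 0 => /=.
by move=> _ [t /= t0 <-]; exact: H.
Qed.

Lemma slope_le_self x : slope x <= p x.
Proof. by have := slope_le x (lexx 0); rewrite scale0r mul0r addr0 subr0. Qed.

Lemma slope_opp : slope (- y) <= - p y.
Proof.
have := slope_le (- y) (@ler01 R).
by rewrite scale1r addNr sublinear0// mul1r sub0r.
Qed.

(** For subadditivity the shifts [t] and [s] of the two arguments combine into [t + s]; for
    homogeneity the shift is rescaled by [a]. *)
Lemma sublinear_slope : sublinear slope.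
Proof.
split=> [x z|].
  rewrite -lerBlDl; apply: slope_glb => s s0; rewrite lerBlDl -lerBlDr.
  apply: slope_glb => t t0; rewrite lerBlDr.
  have := slope_le (x + z) (addr_ge0 t0 s0) => /le_trans; apply.
  have := sp.1 (x + t *: y) (z + s *: y).
  by rewrite addrACA -scalerDl; lra.
apply: sublinear_homo => [a x a0|].
  rewrite mulrC -ler_pdivrMr//; apply: slope_glb => t t0.
  rewrite ler_pdivrMr// mulrC.
  have := slope_le (a *: x) (mulr_ge0 (ltW a0) t0) => /le_trans; apply.
  by rewrite -scalerA -scalerDr (sp.2 _ _ (ltW a0)) mulrBr mulrA.
apply/eqP; rewrite eq_le; apply/andP; split.
  by have := slope_le_self 0; rewrite (sublinear0 sp).
by apply: slope_glb => t t0; rewrite add0r sp.2// subrr.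
Qed.

End slope.

Lemma minimal_sublinear p : sublinear p -> exists f, [/\ sublinear f,
  forall x, f x <= p x &
  forall g, sublinear g -> (forall x, g x <= f x) -> g = f].
Proof.
move=> sp.
pose U := {g : X -> R | sublinear g /\ forall x, g x <= p x}.
(* The order is reversed, so that a maximal element for Zorn's lemma is a minimal functional. A
   nonempty chain is bounded by its pointwise infimum, the empty one by [p]. *)
pose r (g1 g2 : U) := `[< forall x, sval g2 x <= sval g1 x >].
have [|||C totC|[f [sf fp]] fmin] := @Zorn U r.
- by move=> g; apply/asboolP.
- move=> g1 g2 g3 /asboolP g12 /asboolP g23; apply/asboolP => x.
  exact: le_trans (g23 x) (g12 x).
- move=> [g1 H1] [g2 H2] /asboolP g12 /asboolP g21.
  apply: eq_exist; apply/funext => x; apply/eqP; rewrite eq_le.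
  by rewrite (g12 x) (g21 x).
- have [[g0 Cg0]|C0] := pselect (exists g, C g); last first.
    exists (exist _ p (conj sp (fun=> lexx _))) => g Cg; exfalso.
    by apply: C0; exists g.
  pose A x := [set sval g x | g in C].
  have Alb x : lbound (A x) (- p (- x)).
    move=> _ [g Cg <-]; have [sg gp] := svalP g.
    by have := sublinear_opp x sg; have := gp (- x); lra.
  pose m x := inf (A x).
  have m_le g x : C g -> m x <= sval g x.
    by move=> Cg; apply: ge_inf; [exists (- p (- x)); exact: Alb|exists g].
  have m_glb x a : (forall g, C g -> a <= sval g x) -> a <= m x.
    move=> H; apply: lb_le_inf; first by exists (sval g0 x), g0.
    by move=> _ [g Cg <-]; exact: H.
  have sm : sublinear m.
    split=> [x y|].
      rewrite -lerBlDl; apply: (m_glb) => g Cg; rewrite lerBlDl -lerBlDr.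
      apply: (m_glb) => g' Cg'; rewrite lerBlDr.
      (* Of the two members of the chain, the smaller one serves at both [x] and [y]. *)
      have [/asboolP gg'|/asboolP gg'] := totC _ _ Cg Cg'.
        have := (svalP g').1.1 x y; have := gg' y; have := m_le _ (x + y) Cg'.
        lra.
      have := (svalP g).1.1 x y; have := gg' x; have := m_le _ (x + y) Cg.
      lra.
    apply: sublinear_homo => [a x a0|].
      rewrite mulrC -ler_pdivrMr//; apply: (m_glb) => g Cg.
      by rewrite ler_pdivrMr// mulrC -((svalP g).1.2 _ _ (ltW a0)); exact: m_le.
    apply/eqP; rewrite eq_le; apply/andP; split.
      by have := m_le _ 0 Cg0; rewrite (sublinear0 (svalP g0).1).
    by apply: (m_glb) => g Cg; rewrite (sublinear0 (svalP g).1).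
  have mp x : m x <= p x := le_trans (m_le g0 x Cg0) ((svalP g0).2 x).
  exists (exist _ m (conj sm mp)) => g Cg; apply/asboolP => x /=; exact: m_le.
- exists f; split => // g sg gf.
  have gp x : g x <= p x := le_trans (gf x) (fp x).
  have := fmin (exist _ g (conj sg gp)); rewrite /r /= => H.
  by have /asboolP/H/(congr1 sval) : forall x, g x <= f x by [].
Qed.

(** Minimality gives [slope f y = f], hence [f (- y) <= - f y]. So [f] is odd, and subadditivity
    applied to [x + y] and [- y] gives the reverse inequality. *)
Lemma minimal_sublinear_additive f : sublinear f ->
  (forall g, sublinear g -> (forall x, g x <= f x) -> g = f) ->
  forall x y, f (x + y) = f x + f y.
Proof.
move=> sf fmin.
have fN y : f (- y) = - f y.
  apply/eqP; rewrite eq_le; apply/andP; split.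
    have := slope_opp y sf.
    by rewrite (fmin _ (sublinear_slope y sf) (slope_le_self y sf)).
  by have := sublinear_opp y sf; lra.
move=> x y; apply/eqP; rewrite eq_le sf.1 /=.
by have := sf.1 (x + y) (- y); rewrite addrK fN; lra.
Qed.

Lemma hahn_banach p x0 : sublinear p -> exists f : {linear X -> R^o},
  (forall x, f x <= p x) /\ f x0 = p x0.
Proof.
(* Starting below the slope at [x0] instead of below [p] gives [f (- x0) <= - p x0], that is,
   equality at [x0]. *)
move=> sp; have [f [sf fp fmin]] := minimal_sublinear (sublinear_slope x0 sp).
have fD := minimal_sublinear_additive sf fmin.
have fN x : f (- x) = - f x.
  by apply/eqP; rewrite -subr_eq0 opprK -fD addrC subrr sublinear0.
have lf : linear (f : X -> R^o).
  move=> a x y; rewrite fD; congr (_ + _).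
  have [a0|a0] := leP 0 a; first exact: sf.2.
  have na : 0 <= - a by rewrite oppr_ge0 ltW.
  by rewrite -[in LHS](opprK a) scaleNr fN (sf.2 _ _ na) mulNr opprK.
pose fL := GRing.isLinear.Build R X R^o *:%R f lf.
pose F : {linear X -> R^o} := HB.pack f fL.
have Fp x : F x <= p x := le_trans (fp x) (slope_le_self x0 sp x).
exists F; split => //; apply/eqP; rewrite eq_le Fp /=.
have := le_trans (fp (- x0)) (slope_opp x0 sp).
by rewrite fN lerN2.
Qed.

End hahn_banach.

(** * Continuous seminorms on a locally convex space *)

Section seminorm.
Context (R : realType) (X : tvsType R).

Lemma seminorm0 (q : X -> R) : seminorm q -> q 0 = 0.
Proof. by move=> [_ _ /(_ 0 0)]; rewrite scale0r normr0 mul0r. Qed.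

Lemma seminormN (q : X -> R) x : seminorm q -> q (- x) = q x.
Proof. by move=> [_ _ /(_ (-1) x)]; rewrite scaleN1r normrN normr1 mul1r. Qed.

Lemma seminorm_norming (q : X -> R) x0 : seminorm q ->
  exists f : {linear X -> R^o}, (forall x, `|f x| <= q x) /\ f x0 = q x0.
Proof.
move=> sq; have [q0 qD qZ] := sq.
have [|f [fq fx0]] := @hahn_banach R X q x0.
  by split=> // a x a0; rewrite qZ ger0_norm.
exists f; split => // x; rewrite ler_norml fq andbT.
by have := fq (- x); rewrite linearN seminormN//=; lra.
Qed.

Lemma seminorm_dist (q : X -> R) x y : seminorm q -> `|q x - q y| <= q (x - y).
Proof.
move=> sq; have [q0 qD qZ] := sq.
have := qD (x - y) y; have := qD (y - x) x; rewrite !subrK.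
by rewrite -(seminormN (x - y) sq) opprB ler_norml; lra.
Qed.

Lemma continuous_sub_seminorm (q f : X -> R) : seminorm q -> continuous q ->
  (forall x y, `|f x - f y| <= q (x - y)) -> continuous f.
Proof.
move=> sq cq fq x; apply/cvgrPdist_le => e e0.
have c : q (x - y) @[y --> x] --> q (x - x).
  apply: (@continuous_comp X X R (fun y => x - y) q); last exact: cq.
  apply: (@continuous_comp X (X * X)%type X (fun y => (x, y))
    (fun z => z.1 - z.2)); last exact: sub_continuous.
  by apply: cvg_pair => /=; [exact: cvg_cst|exact: cvg_id].
have /cvgrPdist_le/(_ _ e0) := c; apply: filterS => y.
rewrite subrr seminorm0// sub0r normrN; apply: le_trans.
exact: le_trans (fq x y) (ler_norm _).
Qed.

(** The seminorm is the Minkowski gauge of [W], a convex basic neighbourhood of zero intersected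
    with its reflection. *)
Lemma nbhs_seminorm (U : set X) : nbhs (0 : X) U ->
  exists q : X -> R, [/\ seminorm q, continuous q & forall x, q x < 1 -> U x].
Proof.
move=> U0; have [B convB [Bopen Bnbhs]] := @locally_convex R X.
have [b [Bb b0] bU] := Bnbhs 0 U U0.
pose W := [set x | b x /\ b (- x)].
have W0 : nbhs (0 : X) W.
  apply: filterI; first by apply: open_nbhs_nbhs; split => //; exact: Bopen.
  have : nbhs (- (0 : X)) b.
    by rewrite oppr0; apply: open_nbhs_nbhs; split => //; exact: Bopen.
  exact: (@opp_continuous X 0).
have WN x : W x -> W (- x) by rewrite /W /= opprK => -[].
have convb s t x y : 0 <= s -> 0 <= t -> s + t = 1 -> b x -> b y ->
    b (s *: x + t *: y).
  move=> s0 t0 st bx by_.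
  have s01 : 0 <= s <= 1 by rewrite s0/=; lra.
  have := convB b (mem_set Bb) x y (Itv01 s0 (andP s01).2)
    (mem_set bx) (mem_set by_).
  rewrite inE /=; congr b; congr (_ + _ *: _) => /=.
  by rewrite /unstable.onem; lra.
have convW s t x y : 0 <= s -> 0 <= t -> s + t = 1 -> W x -> W y ->
    W (s *: x + t *: y).
  move=> s0 t0 st [bx bnx] [by_ bny]; split; first exact: convb.
  by rewrite opprD -!scalerN; exact: convb.
have W00 : W 0 := nbhs_singleton W0.
pose A x := [set t : R | 0 < t /\ W (t^-1 *: x)].
(* [W] is absorbing: [s *: x] tends to zero with [s]. *)
have A0 x : exists t, A x t.
  have c : s *: x @[s --> (0 : R^o)] --> (0 : R^o) *: x.
    apply: (@continuous_comp R^o (R^o * X)%type X (fun s => (s, x))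
      (fun z => z.1 *: z.2)); last exact: scale_continuous.
    by apply: (@cvg_pair _ _ _ _ (nbhs (0 : R^o))); [exact: cvg_id|exact: cvg_cst].
  rewrite scale0r in c; have /nbhs_ballP[e /= e0 He] := c _ W0.
  exists (e / 2)^-1; split; first by rewrite invr_gt0 divr_gt0.
  rewrite invrK; apply: He; rewrite /ball /= sub0r normrN gtr0_norm ?divr_gt0//.
  by rewrite ltr_pdivrMr// ltr_pMr// ltr1n.
have Alb x : has_lbound (A x) by exists 0 => t [/ltW].
pose q x := inf (A x).
have q_le x t : A x t -> q x <= t by move=> At; exact: ge_inf.
have q_glb x a : (forall t, A x t -> a <= t) -> a <= q x.
  by move=> H; apply: lb_le_inf => //; exact: A0.
have q_lt x a : q x < a -> exists2 t, A x t & t < a.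
  by apply: inf_lt; exact: A0.
have q0 x : 0 <= q x by apply: (q_glb) => t [/ltW].
have qD x y : q (x + y) <= q x + q y.
  rewrite -lerBlDl; apply: (q_glb) => t [t0 Wt]; rewrite lerBlDl -lerBlDr.
  apply: (q_glb) => s [s0 Ws]; rewrite lerBlDr; apply: (q_le); split.
    by rewrite addr_gt0.
  have st0 : 0 < s + t by rewrite addr_gt0.
  have := convW (s / (s + t)) (t / (s + t)) _ _ (divr_ge0 (ltW s0) (ltW st0))
    (divr_ge0 (ltW t0) (ltW st0)) _ Ws Wt.
  rewrite -mulrDl divff ?gt_eqF// => /(_ erefl).
  by rewrite !scalerA ![_ / (s + t) / _]mulrAC !divff ?gt_eqF// !mul1r -scalerDr.
have qN x : q (- x) = q x.
  congr inf; apply/seteqP; split=> t [t0 Wt]; split => //.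
    by rewrite -[t^-1 *: x]opprK -scalerN; exact: WN.
  by rewrite scalerN; exact: WN.
have q00 : q 0 = 0.
  apply/eqP; rewrite eq_le q0 andbT; apply/ler_addgt0Pl => e e0; rewrite addr0.
  by apply: (q_le); split => //; rewrite scaler0.
have qZ0 a x : 0 <= a -> q (a *: x) = a * q x.
  apply: sublinear_homo => // {}a {}x a0.
  rewrite mulrC -ler_pdivrMr//; apply: (q_glb) => t [t0 Wt].
  rewrite ler_pdivrMr//; apply: (q_le); split; first by rewrite mulr_gt0.
  by rewrite scalerA invfM -mulrA mulVf ?mulr1 ?gt_eqF.
have qZ a x : q (a *: x) = `|a| * q x.
  have [a0|a0] := ger0P a; first exact: qZ0.
  by rewrite -qN -scaleNr qZ0// oppr_ge0 ltW.
have sq : seminorm q by split.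
have q1 x : q x < 1 -> W x.
  move=> /q_lt[t [t0 Wt] t1].
  have := convW t (1 - t) _ _ (ltW t0) _ _ Wt W00.
  rewrite subr_ge0 (ltW t1) subrKC scalerA divff ?gt_eqF// scale1r scaler0 addr0.
  exact.
exists q; split => //; last by move=> x /q1[bx _]; exact: bU.
move=> x; apply/cvgrPdist_le => e e0.
(* Continuity: for [y] near [x] the vector [e^-1 *: (x - y)] lies in [W], which means
   [q (x - y) <= e]. *)
have W1 : nbhs (e^-1 *: (x - x)) W by rewrite subrr scaler0.
have c : e^-1 *: (x - y) @[y --> x] --> e^-1 *: (x - x).
  apply: (@continuous_comp X (R^o * X)%type X (fun y => (e^-1, x - y))
    (fun z => z.1 *: z.2)); last exact: scale_continuous.
  apply: (@cvg_pair _ _ _ _ (nbhs (e^-1 : R^o))); first exact: cvg_cst.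
  apply: (@continuous_comp X (X * X)%type X (fun y => (x, y))
    (fun z => z.1 - z.2)); last exact: sub_continuous.
  by apply: cvg_pair => /=; [exact: cvg_cst|exact: cvg_id].
have : \forall y \near x, W (e^-1 *: (x - y)) := c _ W1.
apply: filterS => y Wy.
by apply: (le_trans (seminorm_dist x y sq)); apply: q_le.
Qed.

End seminorm.

(** * Integrals against Borel measures and their truncation *)

Section borel_integral.
Context (R : realType) (X : tvsType R).
Implicit Types (mu : {measure set (borel X) -> \bar R}) (g f q : X -> R).

Lemma open_measurable_borel (A : set X) : open A -> measurable (A : set (borel X)).
Proof. by move=> oA; exact: sub_sigma_algebra. Qed.

Lemma continuous_measurable_borel g : continuous g ->
  measurable_fun [set: borel X] (g : borel X -> R).
Proof.
move=> cg mD; apply: (measurability _ (RGenOInfty.measurableE R)) => //.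
move=> _ [_ [x ->] <-]; rewrite setTI; apply: open_measurable_borel.
by move/continuousP : cg; apply; exact: interval_open.
Qed.

Lemma bounded_continuous_fun g : bounded_continuous g -> bounded_fun g.
Proof.
move=> [_ [C gC]]; exists C; split; first exact: num_real.
by move=> M CM x _ /=; rewrite (le_trans (gC x))// ltW.
Qed.

Lemma bounded_continuous_integrable mu g : (mu setT < +oo)%E ->
  bounded_continuous g -> mu.-integrable [set: borel X] (EFin \o g).
Proof.
move=> muoo bg; apply: measurable_bounded_integrable => //.
  exact: continuous_measurable_borel bg.1.
exact: bounded_continuous_fun.
Qed.

Lemma sigma_functional_Rintegral mu (S : set X) : (mu setT < +oo)%E ->
  mu.-negligible (~` S) -> sigma_functional S (fun g => \int[mu]_x g x).
Proof.
move=> muoo muS; split=> [a g1 g2 b1 b2|C g_ cg gC gS].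
  have i1 := bounded_continuous_integrable muoo b1.
  have i2 := bounded_continuous_integrable muoo b2.
  have i1a : mu.-integrable [set: borel X] (EFin \o (fun x => a * g1 x)).
    apply: bounded_continuous_integrable => //.
    have := bounded_continuous_lin a b1 (bounded_continuous0 _ _).
    by under eq_fun do rewrite addr0.
  by rewrite RintegralD// RintegralZl.
have C0 : 0 <= C := le_trans (normr_ge0 _) (gC 0%N 0).
have [] := @dominated_convergence _ (borel X) R mu [set: borel X] measurableT
  (fun n => EFin \o g_ n) (fun=> 0%E) (fun=> C%:E).
- by move=> n; apply/measurable_EFinP; exact: continuous_measurable_borel.
- exact: measurable_cst.
- apply: (negligibleS _ muS) => x /= H Sx; apply: H => _.
  apply: cvg_EFin; first exact: nearW.
  exact: gS.
- apply: (@bounded_continuous_integrable mu (fun=> C)) => //.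
  by split; [exact: cst_continuous|exists `|C|].
- by apply: aeW => x n _ /=; rewrite lee_fin.
move=> _ _; rewrite integral0 => /fine_cvg; exact.
Qed.

Lemma Rintegral_bound mu g h : (mu setT < +oo)%E -> bounded_continuous g ->
  bounded_continuous h -> (forall x, `|g x| <= h x) ->
  `|\int[mu]_x g x| <= \int[mu]_x h x.
Proof.
move=> muoo bg bh gh; apply: le_trans (le_normr_Rintegral _ _) _ => //.
  exact: bounded_continuous_integrable.
apply: le_Rintegral => //; [|exact: bounded_continuous_integrable].
apply: (@bounded_continuous_integrable mu (fun x => `|g x|)) => //.
have [cg [C gC]] := bg; split; last by exists C => x; rewrite normr_id.
by move=> x; apply: cvg_norm; exact: cg.
Qed.

Lemma Rintegral_truncation_cvg mu f : continuous f ->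
  mu.-integrable [set: borel X] (EFin \o f) ->
  \int[mu]_x clamp (- n%:R) n%:R (f x) @[n --> \oo] --> \int[mu]_x f x.
Proof.
move=> cf intf.
have [] := @dominated_convergence _ (borel X) R mu [set: borel X] measurableT
  (fun n => EFin \o (fun x => clamp (- n%:R) n%:R (f x))) (EFin \o f)
  (fun x => `|f x|%:E).
- move=> n; apply/measurable_EFinP; apply: continuous_measurable_borel.
  exact: continuous_clamp.
- by apply/measurable_EFinP; exact: continuous_measurable_borel.
- apply: aeW => x _; apply: cvg_EFin; first exact: nearW.
  apply: cvg_near_cst; near=> n; rewrite /= clamp_id// -ler_norml.
  by near: n; exact: nbhs_infty_ger.
- exact: integrable_norm.
- apply: aeW => x n _ /=; rewrite lee_fin.
  have := clamp_lipschitz (- n%:R) n%:R (f x) 0.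
  by rewrite [clamp _ _ 0]clamp_id ?subr0// oppr_le0 ler0n.
move=> _ _; rewrite -(fineK (integrable_fin_num measurableT intf)).
by move=> /fine_cvg; exact.
Unshelve. all: by end_near. Qed.

(** Truncation changes [f] only where [|f| > r], hence where [q > r], and there by at most
    [|f| <= q]. The bound depends on [f] only through [q]. *)
Lemma truncation_error mu f q (r e : R) : continuous f -> continuous q ->
  (mu setT < +oo)%E ->
  mu.-integrable [set: borel X] (EFin \o f) -> (forall x, `|f x| <= q x) ->
  0 <= r -> (\int[mu]_(x in [set x | (r <= q x)%R]) (q x)%:E <= e%:E)%E ->
  `|\int[mu]_x f x - \int[mu]_x clamp (- r) r (f x)| <= e.
Proof.
move=> cf cq muoo intf fq r0 qe.
have q0 x : 0 <= q x := le_trans (normr_ge0 _) (fq x).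
have ccf : continuous (fun x => clamp (- r) r (f x)) by exact: continuous_clamp.
have bc : bounded_continuous (fun x => clamp (- r) r (f x)).
  by split=> //; exists r => x; exact: clamp_norm.
have intc := bounded_continuous_integrable muoo bc.
rewrite -RintegralB//.
have intd : mu.-integrable [set: borel X]
    (EFin \o (fun x => f x - clamp (- r) r (f x))).
  by have := integrableB measurableT intf intc.
apply: le_trans (le_normr_Rintegral _ intd) _ => //.
rewrite -lee_fin /Rintegral fineK; last first.
  apply: integrable_fin_num => //.
  exact: (integrable_norm intd).
apply: le_trans qe.
have mq : measurable ([set x | r <= q x] : set (borel X)).
  have := continuous_measurable_borel cq measurableT (measurable_itv `[r, +oo[).
  by rewrite setTI; congr measurable; apply/seteqP; split => x /=;
    rewrite in_itv/= andbT.
rewrite [leRHS]integral_mkcond; apply: ge0_le_integral => //.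
- apply/measurable_EFinP; apply: continuous_measurable_borel => x.
  by apply: cvg_norm; apply: cvgB; [exact: cf|exact: ccf].
- apply: (measurable_restrictT _ mq).1.
  apply/measurable_EFinP.
  by apply: measurable_funS (continuous_measurable_borel cq).
- move=> x _; rewrite patchE; case: ifPn => [|].
    move=> _; rewrite lee_fin; apply: le_trans (fq x).
    have [rf|fr] := leP r `|f x|; last first.
      by rewrite clamp_id ?subrr ?normr0// -ler_norml ltW.
    have [f0|f0] := leP 0 (f x).
      move: rf; rewrite ger0_norm// => rf.
      by rewrite clamp_ge ?ge0_cp// ger0_norm ?subr_ge0//; lra.
    move: rf; rewrite ltr0_norm// => rf.
    by rewrite clamp_le ?ge0_cp//; [rewrite opprK ler0_norm; lra|lra].
  rewrite notin_setE /= => /negP; rewrite -ltNge => qr.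
  rewrite clamp_id ?subrr ?normr0// -ler_norml.
  exact: le_trans (fq x) (ltW qr).
Qed.

(** Convergence of the extended-real suprema to zero makes them both finite and at most [e] from
    some level on; one level serves all [i]. *)
Lemma uniformly_integrable_tail (I : Type)
    (mu_ : I -> {measure set (borel X) -> \bar R}) q (e : R) :
  uniformly_integrable mu_ q -> 0 < e ->
  \forall r \near +oo, forall i,
    (\int[mu_ i]_(x in [set x | (r <= q x)%R]) (q x)%:E <= e%:E)%E.
Proof.
move=> /fine_cvgP[fin /cvgr0Pnorm_le cv0] e0; have cv := cv0 _ e0.
pose tail r := ereal_sup (range (fun i =>
  \int[mu_ i]_(x in [set x | (r <= q x)%R]) (q x)%:E)%E).
have {}fin : \forall r \near +oo, tail r \is a fin_num := fin.
have {}cv : \forall r \near +oo, `|fine (tail r)| <= e := cv.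
near=> r => i.
apply: (@le_trans _ _ (tail r)); first by apply: ereal_sup_ubound; exists i.
have fr : tail r \is a fin_num by near: r.
rewrite -(fineK fr) lee_fin; apply: le_trans (ler_norm _) _.
by near: r.
Unshelve. all: by end_near. Qed.

End borel_integral.

(** * Radon measures are carried by separable sets *)

Lemma tvs_compact_cover (R : realType) (X : tvsType R) (K : set X) :
  compact K -> cover_compact K.
Proof.
(* [compact_cover] concerns pointed spaces; 0 serves as the base point. *)
pose pX : ptopologicalType := HB.pack (Topological.sort X) (isPointed.Build X 0).
by move=> cK; have := @compact_cover pX; move/(congr1 (fun P => P K)) => <-.
Qed.

Section radon_accessible.
Context (R : realType) (X : tvsType R).
Hypothesis hX : hausdorff_space X.
Variable q : X -> R.
Hypotheses (sq : seminorm q) (cq : continuous q).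
Let d (x y : X) := q (x - y).

Lemma seminorm_pseudometric : continuous_pseudometric d.
Proof.
have [q0 qD qZ] := sq; split.
- by move=> x; rewrite /d subrr seminorm0.
- by move=> x y; rewrite /d -opprB seminormN.
- by move=> x y z; have := qD (x - y) (y - z); rewrite addrA subrK.
- move=> a; apply: (continuous_sub_seminorm sq cq) => x y.
  by have := seminorm_dist (x - a) (y - a) sq; rewrite opprB addrA subrK.
Qed.

Lemma open_seminorm_ball a r : open [set x | d x a < r].
Proof.
have [_ _ _ dc] := seminorm_pseudometric; have /continuousP := dc a.
by move=> /(_ _ (@open_lt _ r)).
Qed.

Lemma measurable_accessible (x_ : nat -> X) :
  measurable (accessible d x_ : set (borel X)).
Proof.
have -> : accessible d x_ = \bigcap_k \bigcup_i [set x | d x (x_ i) < k.+1%:R^-1].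
  apply/seteqP; split => [x Ax k _|x Hx e e0].
    have k0 : (0 : R) < k.+1%:R^-1 by rewrite invr_gt0.
    by have [i xi] := Ax _ k0; exists i.
  have [k _ ke] := near_infty_natSinv_lt (PosNum e0).
  have [i _ /= xi] := Hx k I; exists i.
  by apply: lt_trans xi _; exact: ke k (leqnn k).
apply: bigcapT_measurable => k; apply: bigcupT_measurable => i.
by apply: open_measurable_borel; exact: open_seminorm_ball.
Qed.

(** Each measure is carried up to [1 / (p + 1)] by a compact set, and each compact set has a finite
    [1 / (r + 1)]-net for [d]. The countably many nets are listed in one sequence. *)
Lemma radon_accessible (mu_ : nat -> {measure set (borel X) -> \bar R}) :
  (forall n, radon (mu_ n)) -> exists x_ : nat -> X,
    forall n, (mu_ n).-negligible (~` accessible d x_).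
Proof.
move=> rmu; have [d0 _ _ dc] := seminorm_pseudometric.
have pos (k : nat) : (0 : R) < k.+1%:R^-1 by rewrite invr_gt0.
have /choice[K HK] : forall np : nat * nat, exists K : set X,
    compact K /\ (mu_ np.1 (~` K) < (np.2.+1%:R^-1)%:E)%E.
  move=> [n p]; have [K [cK _ HK]] := (rmu n).2 setT _ measurableT (pos p).
  by exists K; split => //; rewrite -setTD.
have /choice[F HF] : forall npr : nat * nat * nat, exists s : seq X,
    forall x, K npr.1 x -> exists2 y, y \in s & d x y < npr.2.+1%:R^-1.
  move=> [np r]; have [cK _] := HK np.
  have [y _|x _|D _ KD] := tvs_compact_cover cK (D := [set: X])
    (f := fun y => [set x | d x y < r.+1%:R^-1]).
  - exact: open_seminorm_ball.
  - by exists x => //=; rewrite d0.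
  - by exists (finmap.enum_fset D) => x /KD[y /= yD xy]; exists y.
(* The value 0 at codes that name no point of a net is harmless: additional centers only enlarge the
   accessible set. *)
pose x_ k := if unpickle k is Some (npr, i) then nth 0 (F npr) i else 0.
exists x_ => n; exists (~` accessible d x_); split => //.
  by apply: measurableC; exact: measurable_accessible.
apply/eqP; rewrite eq_le measure_ge0 andbT.
apply/lee_addgt0Pr => e e0; rewrite add0e.
have [p _ pe] := near_infty_natSinv_lt (PosNum e0).
have [cK Kp] := HK (n, p).
apply: le_trans (_ : mu_ n (~` K (n, p)) <= _)%E.
  apply: le_measure; rewrite ?inE.
  - by apply: measurableC; exact: measurable_accessible.
  - by apply: open_measurable_borel; apply: closed_openC; exact: compact_closed.
  - apply: subsetC => x Kx r r0.
    have [m _ mr] := near_infty_natSinv_lt (PosNum r0).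
    have [y yF xy] := HF (n, p, m) x Kx.
    exists (pickle (n, p, m, index y (F (n, p, m)))).
    rewrite /x_ pickleK nth_index//; apply: lt_trans xy _.
    exact: mr m (leqnn m).
apply: ltW; apply: lt_trans Kp _; rewrite lte_fin.
exact: pe p (leqnn p).
Qed.

End radon_accessible.

(** * Integrals against signed measures *)

Lemma sigma_functional_sub (R : realType) (T : topologicalType) (S : set T)
    (l1 l2 : (T -> R) -> R) : sigma_functional S l1 -> sigma_functional S l2 ->
  sigma_functional S (fun g => l1 g - l2 g).
Proof.
move=> h1 h2; split=> [a g1 g2 b1 b2|C g_ cg gC gS].
  by rewrite h1.1// h2.1//; ring.
suff : l1 (g_ n) - l2 (g_ n) @[n --> \oo] --> (0 - 0 : R) by rewrite subr0.
by apply: cvgB; [exact: h1.2 cg gC gS|exact: h2.2 cg gC gS].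
Qed.

Section charge_integral.
Context (R : realType) (X : tvsType R).
Variable nu : {charge set (borel X) -> \bar R}.
Local Notation P := (jordan_pos (hahn_posneg nu)).
Local Notation N := (jordan_neg (hahn_posneg nu)).
Local Notation V := (charge_total_variation nu).

Lemma integral_total_variation (D : set (borel X)) (f : borel X -> \bar R) :
  measurable D -> (forall x, D x -> (0 <= f x)%E) -> measurable_fun D f ->
  (\int[V]_(x in D) f x = \int[P]_(x in D) f x + \int[N]_(x in D) f x)%E.
Proof.
move=> mD f0 mf; rewrite -ge0_integral_measure_add//.
by apply: eq_measure_integral => A mA _; apply: esym; exact: measure_addE.
Qed.

Lemma jordan_finite : (P setT < +oo)%E /\ (N setT < +oo)%E.
Proof. by split; rewrite ltey_eq fin_num_measure. Qed.

Lemma jordan_negligible (A : set (borel X)) : V.-negligible A ->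
  P.-negligible A /\ N.-negligible A.
Proof.
move=> [B [mB VB AB]].
have : (P B + N B = 0)%E by exact: VB.
move=> /eqP; rewrite padde_eq0 ?measure_ge0// => /andP[/eqP PB /eqP NB].
by split; exists B.
Qed.

Lemma jordan_integrable (f : X -> R) :
  V.-integrable [set: borel X] (EFin \o f) ->
  P.-integrable [set: borel X] (EFin \o f) /\
  N.-integrable [set: borel X] (EFin \o f).
Proof.
move=> /integrableP[mf]; rewrite integral_total_variation//; last first.
  exact: measurableT_comp.
move=> PN; split; apply/integrableP; split => //; apply: le_lt_trans PN.
  by apply: leeDl; exact: integral_ge0.
by apply: leeDr; exact: integral_ge0.
Qed.

Lemma sigma_functional_charge (S : set X) : V.-negligible (~` S) ->
  sigma_functional S (charge_integral nu).
Proof.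
move=> /jordan_negligible[Pn Nn]; have [Pf Nf] := jordan_finite.
by apply: sigma_functional_sub; exact: sigma_functional_Rintegral.
Qed.

Lemma charge_truncation_cvg (f : X -> R) : continuous f ->
  V.-integrable [set: borel X] (EFin \o f) ->
  charge_integral nu (fun x => clamp (- n%:R) n%:R (f x)) @[n --> \oo] -->
  charge_integral nu f.
Proof.
by move=> cf /jordan_integrable[iP iN]; apply: cvgB;
  exact: Rintegral_truncation_cvg.
Qed.

(** The tail of the total variation dominates the tails of both Jordan parts, each of which
    contributes one [e]. *)
Lemma charge_truncation_error (f q : X -> R) (r e : R) :
  continuous f -> continuous q ->
  V.-integrable [set: borel X] (EFin \o f) -> (forall x, `|f x| <= q x) ->
  0 <= r -> (\int[V]_(x in [set x | (r <= q x)%R]) (q x)%:E <= e%:E)%E ->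
  `|charge_integral nu f - charge_integral nu (fun x => clamp (- r) r (f x))|
    <= 2 * e.
Proof.
move=> cf cq /jordan_integrable[iP iN] fq r0; have [Pf Nf] := jordan_finite.
have mq := continuous_measurable_borel cq.
have q0 x : (0 <= (q x)%:E)%E by rewrite lee_fin (le_trans _ (fq x)).
rewrite integral_total_variation//; last 2 first.
- have := mq measurableT _ (measurable_itv `[r, +oo[).
  by rewrite setTI; congr measurable; apply/seteqP; split => x /=;
    rewrite in_itv/= andbT.
- by apply/measurable_EFinP; exact: measurable_funS mq.
move=> PN.
have hP : `|\int[P]_x f x - \int[P]_x clamp (- r) r (f x)| <= e.
  apply: (truncation_error cf cq) => //; apply: le_trans PN.
  by apply: leeDl; exact: integral_ge0.
have hN : `|\int[N]_x f x - \int[N]_x clamp (- r) r (f x)| <= e.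
  apply: (truncation_error cf cq) => //; apply: le_trans PN.
  by apply: leeDr; exact: integral_ge0.
move: hP hN; rewrite /charge_integral !ler_norml; lra.
Qed.

End charge_integral.

(** * From truncations to limits, and from weak limits to limits *)

Lemma cvg_truncations (R : realType) (I : Type) (F : set_system I)
    (FF : Filter F) (a_ : I -> R) (a : R) (b_ : nat -> I -> R) (b : nat -> R) :
  (forall n, b_ n i @[i --> F] --> b n) -> b n @[n --> \oo] --> a ->
  (forall e, 0 < e -> \forall n \near \oo, forall i, `|a_ i - b_ n i| <= e) ->
  a_ i @[i --> F] --> a.
Proof.
move=> b_b ba ab; apply/cvgrPdist_le => e e0.
have e3 : 0 < e / 3 by rewrite divr_gt0.
have /cvgrPdist_le/(_ _ e3) ba3 := ba.
have [n [ban abn]] := filter_ex (filterI ba3 (ab _ e3)).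
have /cvgrPdist_le/(_ _ e3) := b_b n; apply: filterS => i.
move: ban (abn i) => /=; rewrite !ler_norml; lra.
Qed.

Section tvs_convergence.
Context (R : realType) (X : tvsType R).

Lemma continuous_linear_seminorm (q : X -> R) (f : {linear X -> R^o}) :
  seminorm q -> continuous q -> (forall x, `|f x| <= q x) -> continuous f.
Proof.
move=> sq cq fq.
have := @continuous_sub_seminorm _ _ q (f : X -> R) sq cq; apply => x y.
by rewrite -linearB.
Qed.

Lemma linear_seminorm (f : {linear X -> R^o}) : continuous f ->
  seminorm (fun x => `|f x| : R) /\ continuous (fun x => `|f x| : R).
Proof.
move=> cf; split; last by move=> x; apply: cvg_norm; exact: cf.
split=> [//|x y|a x]; first by rewrite linearD ler_normD.
by rewrite linearZ normrM.
Qed.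

(** With [i] fixed, a functional norming [m_ i - m] for [q] takes there the limit over [j] of its
    values at [m_ i - m_ j], which are at most [q (m_ i - m_ j)]. So the Cauchy bound passes to
    [q (m_ i - m)]. *)
Lemma cvg_weak_cauchy (I : Type) (F : set_system I) (FF : ProperFilter F)
    (m_ : I -> X) (m : X) :
  (forall f : {linear X -> R^o}, continuous f ->
    f (m_ i) @[i --> F] --> f m) ->
  (forall q : X -> R, seminorm q -> continuous q -> forall e, 0 < e ->
    exists2 A, F A & forall i j, A i -> A j -> q (m_ i - m_ j) <= e) ->
  m_ i @[i --> F] --> m.
Proof.
move=> weak cauchy U mU.
have U0 : nbhs (0 : X) [set x | U (x + m)].
  have c : x + m @[x --> (0 : X)] --> 0 + m.
    apply: (@continuous_comp X (X * X)%type X (fun x => (x, m))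
      (fun z => z.1 + z.2)); last exact: add_continuous.
    by apply: (@cvg_pair _ _ _ _ (nbhs (0 : X))); [exact: cvg_id|exact: cvg_cst].
  by apply: c; rewrite add0r.
have [q [sq cq qU]] := nbhs_seminorm U0.
have h0 : (0 : R) < 2^-1 by rewrite invr_gt0.
have [A FA qA] := cauchy q sq cq _ h0.
suff : \forall i \near F, U (m_ i) by [].
apply: filterS (FA) => i Ai; rewrite -[m_ i](subrK m); apply: qU.
suff : q (m_ i - m) <= 2^-1.
  by move=> /le_lt_trans; apply; rewrite invf_lt1// ltr1n.
have [f [fq <-]] := seminorm_norming (m_ i - m) sq.
apply/ler_addgt0Pr => e e0.
have /cvgrPdist_le/(_ _ e0) fm := weak f (continuous_linear_seminorm sq cq fq).
have [j [Aj fj]] := filter_ex (filterI FA fm).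
have := le_trans (ler_norm _) (le_trans (fq (m_ i - m_ j)) (qA i j Ai Aj)).
move: fj; rewrite /= !linearB ler_norml /=; lra.
Qed.

End tvs_convergence.

(** * Uniform convergence along nets of probability measures *)

Section nets_of_probabilities.
Context (R : realType) (X : tvsType R).

(* On the support of [mu] finitely many bumps carry almost all of [mu], hence
   almost all of [mu_ i] for [i] large, and equicontinuous functions are
   combinations of these bumps up to a small error. *)
Lemma weak_cvg_equicontinuous (I : Type) (F : set_system I) (FF : Filter F)
    (mu_ : I -> probability (borel X) R) (mu : probability (borel X) R)
    (d : X -> X -> R) (x_ : nat -> X) (B : R) :
  continuous_pseudometric d -> mu.-negligible (~` accessible d x_) ->
  weak_cvg F mu_ mu -> forall e, 0 < e -> \forall i \near F,
    forall f : X -> R, (forall x y, `|f x - f y| <= d x y) ->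
      (forall x, `|f x| <= B) ->
      `|\int[mu_ i]_x f x - \int[mu]_x f x| <= e.
Proof.
move=> dP muS wcv e e0.
have [B0|B0] := leP 0 B; last first.
  apply: nearW => i f _ fB; have := le_trans (normr_ge0 _) (fB 0).
  by rewrite leNgt B0.
pose s := e / 8; have s0 : 0 < s by rewrite divr_gt0.
have [h [hh h0 h1 hd hS]] := partition_of_unity x_ dP s0.
have bh k : bounded_continuous (h k) by exact: bounded_continuous_summand.
have ltoo (p : probability (borel X) R) :
    ((p : {measure set (borel X) -> \bar R}) setT < +oo)%E.
  exact: (le_lt_trans (probability_le1 p measurableT) (ltry 1)).
have linT (p : probability (borel X) R) :
    sigma_functional [set: X] (fun g => \int[p]_x g x).
  apply: sigma_functional_Rintegral (ltoo p) _.
  by exists set0; split => // x /(_ Logic.I).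
have linS : sigma_functional (accessible d x_) (fun g => \int[mu]_x g x).
  exact: sigma_functional_Rintegral (ltoo mu) muS.
pose theta N x := \sum_(0 <= k < N) 1 * h k x.
have btheta N : bounded_continuous (theta N) by exact: bounded_continuous_sum.
have theta1 N x : 0 <= theta N x <= 1.
  rewrite /theta; under eq_bigr do rewrite mul1r.
  by rewrite h1 andbT sumr_ge0.
have b1 : bounded_continuous (fun _ : X => 1 : R).
  by split; [exact: cst_continuous|exists 1 => x; rewrite normr1].
have b1theta N : bounded_continuous (fun x => 1 - theta N x).
  have := bounded_continuous_lin (-1) (btheta N) b1.
  by under eq_fun do rewrite mulN1r addrC.
have B1 : 0 < B + 1 by rewrite ltr_wpDl.
have s1 : 0 < s / (B + 1) by rewrite divr_gt0.
have Bs : B * (s / (B + 1)) <= s.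
  by rewrite mulrCA ger_pMr// ler_pdivrMr// mul1r lerDl.
have [N HN] : exists N, \int[mu]_x (1 - theta N x) <= s / (B + 1).
  have : \int[mu]_x (1 - theta n x) @[n --> \oo] --> (0 : R).
    apply: (linS.2 1 (fun n x => 1 - theta n x) (fun n => (b1theta n).1)).
      by move=> n x; have := theta1 n x; rewrite ler_norml; lra.
    move=> x /hS cx; suff : 1 - theta n x @[n --> \oo] --> (1 - 1 : R).
      by rewrite subrr.
    apply: cvgB; first exact: cvg_cst.
    by rewrite /theta; under eq_fun do under eq_bigr do rewrite mul1r.
  move=> /cvgr0Pnorm_le/(_ _ s1)[n _ Hn]; exists n.
  exact: le_trans (ler_norm _) (Hn n (leqnn n)).
have approx (p : probability (borel X) R) (f : X -> R) :
    (forall x y, `|f x - f y| <= d x y) -> (forall x, `|f x| <= B) ->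
    `|\int[p]_x f x - \sum_(0 <= k < N) f (x_ k) * \int[p]_x h k x| <=
    s + B * \int[p]_x (1 - theta N x).
  move=> fd fB; have bf : bounded_continuous f.
    by split; [exact: continuous_lipschitz fd|exists B].
  have bP : bounded_continuous (fun x => \sum_(0 <= k < N) f (x_ k) * h k x).
    exact: bounded_continuous_sum.
  rewrite -(sigma_functional_sum (linT p))// -(sigma_functionalB (linT p))//.
  have bs : bounded_continuous (fun _ : X => s).
    by split; [exact: cst_continuous|exists `|s|].
  have -> : s + B * \int[p]_x (1 - theta N x) =
      \int[p]_x (B * (1 - theta N x) + s).
    rewrite (linT p).1// addrC Rintegral_cst//; congr (_ + _).
    have p1 : fine ((p : {measure set (borel X) -> \bar R}) setT) = 1.
      exact: (congr1 fine (@probability_setT _ _ _ p)).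
    by rewrite p1 mulr1.
  apply: Rintegral_bound => //.
  - have := bounded_continuous_lin (-1) bP bf.
    by under eq_fun do rewrite mulN1r addrC.
  - exact: bounded_continuous_lin.
  move=> x.
  have -> : f x - \sum_(0 <= k < N) f (x_ k) * h k x =
      f x * (1 - theta N x) + \sum_(0 <= k < N) (f x - f (x_ k)) * h k x.
    under [in RHS]eq_bigr do rewrite mulrBl.
    rewrite sumrB -mulr_sumr /theta; under [in RHS]eq_bigr do rewrite mul1r.
    by ring.
  apply: le_trans (ler_normD _ _) _; apply: lerD.
    by rewrite normrM ler_pM// ger0_norm//; have := theta1 N x; lra.
  apply: le_trans (ler_norm_sum _ _ _) _.
  apply: le_trans (ler_piMr (ltW s0) (h1 N x)); rewrite mulr_sumr.
  apply: ler_sum => k _; rewrite normrM [X in _ * X]ger0_norm//.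
  have [->|hk] := eqVneq (h k x) 0; first by rewrite !mulr0.
  by rewrite ler_wpM2r// (le_trans (fd _ _))// hd.
have cvh g : bounded_continuous g ->
    \int[mu_ i]_x g x @[i --> F] --> \int[mu]_x g x.
  by move=> bg; apply: wcv; [exact: bg.1|exact: bounded_continuous_fun].
have cvD : \sum_(0 <= k < N) `|\int[mu_ i]_x h k x - \int[mu]_x h k x|
    @[i --> F] --> (0 : R).
  elim: N {HN approx} => [|N IH].
    by under eq_fun do rewrite big_geq//; exact: cvg_cst.
  under eq_fun do rewrite big_nat_recr//=.
  have c0 : `|\int[mu_ i]_x h N x - \int[mu]_x h N x| @[i --> F] --> (0 : R).
    by apply/norm_cvg0P/subr_cvg0; exact: cvh.
  have := cvgD IH c0; rewrite addr0; exact.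
have /cvgr0Pnorm_le/(_ _ s1) := cvD.
have /cvgrPdist_le/(_ _ s1) := cvh _ (b1theta N).
apply: filterS2 => i thi Di f fd fB.
have hi := approx (mu_ i) f fd fB; have h_mu := approx mu f fd fB.
have H1 : B * \int[mu_ i]_x (1 - theta N x) <= s + s.
  apply: le_trans (_ : B * (s / (B + 1) + s / (B + 1)) <= _).
    by apply: ler_wpM2l => //; move: thi; rewrite ler_norml; lra.
  by rewrite mulrDr lerD.
have H2 : B * \int[mu]_x (1 - theta N x) <= s.
  by apply: le_trans Bs; rewrite ler_wpM2l.
have H3 : `|\sum_(0 <= k < N) f (x_ k) * \int[mu_ i]_x h k x -
    \sum_(0 <= k < N) f (x_ k) * \int[mu]_x h k x| <= s.
  rewrite -sumrB; apply: le_trans (ler_norm_sum _ _ _) _.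
  apply: le_trans Bs; apply: le_trans (ler_wpM2l B0 (le_trans (ler_norm _) Di)).
  rewrite mulr_sumr; apply: ler_sum => k _.
  by rewrite -mulrBr normrM ler_wpM2r.
have e8 : e = 8 * s by rewrite /s mulrCA divff// mulr1.
move: hi h_mu H1 H2 H3; rewrite e8 !ler_norml; lra.
Qed.

End nets_of_probabilities.

Lemma tails_proper (I : Type) (le : I -> I -> Prop) :
  directed_preorder le -> ProperFilter (tails le).
Proof.
move=> [[i0] lexx letr dir]; apply: filter_from_proper; last first.
  by move=> i _; exists i; exact: lexx.
apply: filter_from_filter; first by exists i0.
move=> i j _ _; have [k [ik jk]] := dir i j; exists k => // l kl.
by split; [exact: letr ik kl|exact: letr jk kl].
Qed.

Lemma near_pinfty_nat (R : realType) (P : R -> Prop) :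
  (\forall r \near +oo, P r) -> \forall n \near \oo, P n%:R.
Proof. by move=> /(@cvgr_idn R). Qed.

Lemma near_pinfty_pos (R : realType) (P : R -> Prop) :
  (\forall r \near +oo, P r) -> exists2 r, 0 <= r & P r.
Proof.
move=> nP; have [r [r0 Pr]] := filter_ex (filterI (nbhs_pinfty_ge (num_real 0)) nP).
by exists r.
Qed.

Section charges.
Context (R : realType) (X : tvsType R) (hX : hausdorff_space X).
Variables (mu_ : nat -> {charge set (borel X) -> \bar R})
  (mu : {charge set (borel X) -> \bar R}) (m_ : nat -> X) (m : X).
Hypothesis rmu_ : forall n, radon_charge (mu_ n).
Hypothesis mean_ : forall n, is_charge_mean (mu_ n) (m_ n).
Hypothesis mean : is_charge_mean mu m.
Hypothesis wcv : weak_charge_cvg \oo mu_ mu.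
Hypothesis ui : forall q : X -> R, seminorm q -> continuous q ->
  uniformly_integrable (fun n => charge_total_variation (mu_ n)) q.

Lemma charge_mean_weak_cvg (f : {linear X -> R^o}) : continuous f ->
  f (m_ n) @[n --> \oo] --> f m.
Proof.
move=> cf; have [sq cq] := linear_seminorm cf.
have [intf ->] := mean cf.
under eq_fun do rewrite (mean_ _ cf).2.
apply: (@cvg_truncations _ _ _ _ _ _
  (fun k n => charge_integral (mu_ n) (fun x => clamp (- k%:R) k%:R (f x))) _ _
  (charge_truncation_cvg cf intf)).
  move=> k; apply: wcv; first exact: continuous_clamp.
  apply: bounded_continuous_fun; split; first exact: continuous_clamp.
  by exists k%:R => x; exact: clamp_norm.
move=> e e0; have e2 : 0 < e / 2 by rewrite divr_gt0.
have := near_pinfty_nat (uniformly_integrable_tail (ui sq cq) e2).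
apply: filterS => k Hk n.
have := charge_truncation_error cf cq (mean_ n cf).1 (fun=> lexx _) (ler0n R k)
  (Hk n).
by rewrite mulrC divfK.
Qed.

Lemma charge_mean_cauchy (q : X -> R) : seminorm q -> continuous q ->
  forall e, 0 < e -> exists2 A : set nat, \oo A &
    forall i j, A i -> A j -> q (m_ i - m_ j) <= e.
Proof.
move=> sq cq e e0; apply: contrapT => H.
have /choice[ij Hij] : forall N : nat, exists p : nat * nat,
    [/\ (N <= p.1)%N, (N <= p.2)%N & e < q (m_ p.1 - m_ p.2)].
  move=> N; apply: contrapT => K; apply: H; exists [set n | (N <= n)%N].
    by exists N.
  move=> i j /= Ni Nj; rewrite leNgt; apply/negP => qe.
  by apply: K; exists (i, j).
pose a N := (ij N).1; pose b N := (ij N).2.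
have a_oo : a n @[n --> \oo] --> \oo.
  move=> A [N _ NA]; exists N => // k /= Nk; apply: NA => /=.
  by have [ka _ _] := Hij k; exact: leq_trans ka.
have b_oo : b n @[n --> \oo] --> \oo.
  move=> A [N _ NA]; exists N => // k /= Nk; apply: NA => /=.
  by have [_ kb _] := Hij k; exact: leq_trans kb.
have /choice[f_ Hf] : forall N, exists f : {linear X -> R^o},
    (forall x, `|f x| <= q x) /\ f (m_ (a N) - m_ (b N)) = q (m_ (a N) - m_ (b N)).
  by move=> N; exact: seminorm_norming.
have cf N : continuous (f_ N).
  by apply: continuous_linear_seminorm sq cq _; have [] := Hf N.
have e8 : 0 < e / 8 by rewrite divr_gt0.
have [r r0 Hr] := near_pinfty_pos (uniformly_integrable_tail (ui sq cq) e8).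
have [x_ Hx] := radon_accessible hX sq cq rmu_.
pose l_ N (g : X -> R) :=
  charge_integral (mu_ (a N)) g - charge_integral (mu_ (b N)) g.
have hl N : sigma_functional (accessible (fun x y => q (x - y)) x_) (l_ N).
  by apply: sigma_functional_sub; apply: sigma_functional_charge; exact: Hx.
have l0 g : bounded_continuous g -> l_ n g @[n --> \oo] --> (0 : R).
  move=> bg; have cv := wcv bg.1 (bounded_continuous_fun bg).
  rewrite -(subrr (charge_integral mu g)).
  by apply: cvgB; [exact: cvg_comp a_oo cv|exact: cvg_comp b_oo cv].
have lip N x y : `|clamp (- r) r (f_ N x) - clamp (- r) r (f_ N y)| <= q (x - y).
  apply: le_trans (clamp_lipschitz _ _ _ _) _; rewrite -linearB.
  by have [fq _] := Hf N; exact: fq.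
have := sigma_functional_equicontinuous (seminorm_pseudometric sq cq) hl l0 lip
  (fun N x => clamp_norm (f_ N x) r0).
move=> /cvgr0Pnorm_le/(_ _ e8)[N _ /(_ N (leqnn N))].
have [fq fN] := Hf N; have [_ _ eN] := Hij N.
have ha := charge_truncation_error (cf N) cq (mean_ (a N) (cf N)).1 fq r0 (Hr (a N)).
have hb := charge_truncation_error (cf N) cq (mean_ (b N) (cf N)).1 fq r0 (Hr (b N)).
move: eN; rewrite -/(a N) -/(b N) -fN linearB.
move: ha hb; rewrite -(mean_ (a N) (cf N)).2 -(mean_ (b N) (cf N)).2 /l_ /=.
rewrite !ler_norml; lra.
Qed.

Lemma charge_mean_cvg : m_ n @[n --> \oo] --> m.
Proof.
apply: cvg_weak_cauchy; first exact: charge_mean_weak_cvg.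
exact: charge_mean_cauchy.
Qed.

End charges.

Section probabilities.
Context (R : realType) (X : tvsType R) (hX : hausdorff_space X).
Variables (I : Type) (F : set_system I).
Context {FF : ProperFilter F}.
Variables (mu_ : I -> probability (borel X) R) (mu : probability (borel X) R)
  (m_ : I -> X) (m : X).
Hypothesis rmu : radon mu.
Hypothesis mean_ : forall i, is_mean (mu_ i) (m_ i).
Hypothesis mean : is_mean mu m.
Hypothesis wcv : weak_cvg F mu_ mu.
Hypothesis ui : forall q : X -> R, seminorm q -> continuous q ->
  uniformly_integrable mu_ q.

Let ltoo (p : probability (borel X) R) :
  ((p : {measure set (borel X) -> \bar R}) setT < +oo)%E.
Proof. exact: (le_lt_trans (probability_le1 p measurableT) (ltry 1)). Qed.

Lemma mean_weak_cvg (f : {linear X -> R^o}) : continuous f ->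
  f (m_ i) @[i --> F] --> f m.
Proof.
move=> cf; have [sq cq] := linear_seminorm cf.
have [intf ->] := mean cf.
under eq_fun do rewrite (mean_ _ cf).2.
apply: (@cvg_truncations _ _ _ _ _ _
  (fun k i => \int[mu_ i]_x clamp (- k%:R) k%:R (f x)) _ _
  (Rintegral_truncation_cvg cf intf)).
  move=> k; apply: wcv; first exact: continuous_clamp.
  apply: bounded_continuous_fun; split; first exact: continuous_clamp.
  by exists k%:R => x; exact: clamp_norm.
move=> e e0.
have := near_pinfty_nat (uniformly_integrable_tail (ui sq cq) e0).
apply: filterS => k Hk i.
exact: (truncation_error cf cq (ltoo _) (mean_ i cf).1 (fun=> lexx _) (ler0n R k)
  (Hk i)).
Qed.

Lemma mean_cauchy (q : X -> R) : seminorm q -> continuous q ->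
  forall e, 0 < e -> exists2 A, F A &
    forall i j, A i -> A j -> q (m_ i - m_ j) <= e.
Proof.
move=> sq cq e e0; have e4 : 0 < e / 4 by rewrite divr_gt0.
have [r r0 Hr] := near_pinfty_pos (uniformly_integrable_tail (ui sq cq) e4).
have [x_ /(_ 0%N) Hx] := radon_accessible hX sq cq (fun _ : nat => rmu).
have FA := weak_cvg_equicontinuous FF r (seminorm_pseudometric sq cq) Hx wcv e4.
eexists; [exact: FA|move=> i j /= Ai Aj].
have [f [fq <-]] := seminorm_norming (m_ i - m_ j) sq.
have cf := continuous_linear_seminorm sq cq fq.
have lip x y : `|clamp (- r) r (f x) - clamp (- r) r (f y)| <= q (x - y).
  by apply: le_trans (clamp_lipschitz _ _ _ _) _; rewrite -linearB.
have b x : `|clamp (- r) r (f x)| <= r by exact: clamp_norm.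
have := Ai _ lip b; have := Aj _ lip b.
have := truncation_error cf cq (ltoo _) (mean_ i cf).1 fq r0 (Hr i).
have := truncation_error cf cq (ltoo _) (mean_ j cf).1 fq r0 (Hr j).
rewrite linearB (mean_ i cf).2 (mean_ j cf).2 !ler_norml; lra.
Qed.

Lemma mean_cvg : m_ i @[i --> F] --> m.
Proof. by apply: cvg_weak_cauchy; [exact: mean_weak_cvg|exact: mean_cauchy]. Qed.

End probabilities.

Theorem corollary3p1 (R : realType) (X : tvsType R) (hX : hausdorff_space X) :
  (forall (mu_ : nat -> {charge set (borel X) -> \bar R})
      (mu : {charge set (borel X) -> \bar R}) (m_ : nat -> X) (m : X),
    (forall n, radon_charge (mu_ n)) -> radon_charge mu ->
    (forall n, is_charge_mean (mu_ n) (m_ n)) -> is_charge_mean mu m ->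
    weak_charge_cvg \oo mu_ mu ->
    (forall q : X -> R, seminorm q -> continuous q ->
       uniformly_integrable (fun n => charge_total_variation (mu_ n)) q) ->
    m_ n @[n --> \oo] --> m) /\
  (forall (I : Type) (le : I -> I -> Prop), directed_preorder le ->
    forall (mu_ : I -> probability (borel X) R) (mu : probability (borel X) R)
      (m_ : I -> X) (m : X),
    (forall i, radon (mu_ i)) -> radon mu ->
    (forall i, is_mean (mu_ i) (m_ i)) -> is_mean mu m ->
    weak_cvg (tails le) mu_ mu ->
    (forall q : X -> R, seminorm q -> continuous q ->
       uniformly_integrable mu_ q) ->
    m_ i @[i --> tails le] --> m).
Proof.
split=> [mu_ mu m_ m rmu_ _|I le dir mu_ mu m_ m _ rmu] mean_ mean wcv ui.
  by have := charge_mean_cvg hX rmu_ mean_ mean wcv ui.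
have FF := tails_proper dir.
have := mean_cvg (FF := FF) hX rmu mean_ mean wcv ui.
exact.
Qed.
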